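(* Let $B$ be a mutation Dynkin gss matrix, so $B=\mu_{k_\ell}\cdots\mu_{k_1}B_\Delta$ where $\tilde B_\Delta$ is an (integer) skew-symmetrizable matrix of Dynkin type $\Delta$ and $B_\Delta=t\tilde B_\Delta$. Write $\Phi=\Phi_B$ and $\Phi_\Delta=\Phi_{B_\Delta}$, let $S_B=\{\alpha_1,\dots,\alpha_n\}$ be the simple roots of $B$, and let $\rho=\rho_{k_1}\cdots\rho_{k_\ell}:\Phi\to\Phi_\Delta$ be the composite of the mutations of roots. Then $\rho(S_B)$ is a signed companion basis for $B$; that is, setting $\gamma_i=\rho(\alpha_i)$, the set $\{\gamma_i\}_{i=1}^n$ is a $\mathbb Z$-basis of $\mathbb Z\Phi_\Delta$ and the matrix with $(i,j)$ entry $(\gamma_j,\gamma_i^\vee)$ equals $C(B)$.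
   Context: **Gss matrices and mutation.** All matrices are $n\times n$. A generalized skew-symmetrizable (gss) matrix is $B=(b_{ij})$ with entries in $\mathbb Z[t]/(t^2-1)$ such that there are positive integers $d_1,\dots,d_n$ with $d_ib_{ij}=-d_jb_{ji}$ for all $i,j$; $D=\operatorname{diag}(d_1,\dots,d_n)$ is a skew-symmetrizing matrix. For a real number $a\neq0$, $\operatorname{sgn}(a)=a/|a|$, $\operatorname{sgn}(0)=0$; and $\operatorname{sgn}(a+bt)=\operatorname{sgn}(a+b)$. The signed mutation $\mu_k(B)=(b'_{ij})$ is: $b'_{ij}=-b_{ij}$ if ($i=k$ and $\operatorname{sgn}(b_{ij})=1$) or ($j=k$ and $\operatorname{sgn}(b_{ij})=-1$); $b'_{ij}=-tb_{ij}$ if ($i=k$ and $\operatorname{sgn}(b_{ij})=-1$) or ($j=k$ and $\operatorname{sgn}(b_{ij})=1$); $b'_{ij}=t(b_{ij}+\operatorname{sgn}(b_{ik})b_{ik}b_{kj})$ if $\operatorname{sgn}(b_{ik}b_{kj})=1$; $b'_{ij}=b_{ij}$ otherwise. Mutation preserves skew-symmetrizing matrices; fix one $D$ for the whole mutation sequence. Two gss matrices are mutation equivalent if one is obtained from the other by a finite sequence of mutations. **Dynkin.** $B$ is pure if every entry lies in $\mathbb Z\cup t\mathbb Z$. The unsigned diagram of a pure gss matrix has $|b_{ij}(1)b_{ji}(1)|$ edges between $i$ and $j$, with $i>j$ iff $|b_{ij}(1)|>|b_{ji}(1)|$ (evaluation at $t=1$), drawn as a multiple edge pointing from the larger to the smaller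 vertex. A gss matrix is Dynkin of type $\Delta$ if it is pure with unsigned diagram a Dynkin diagram $\Delta$ ($A_n,B_n,C_n,D_n,E_n,F_4,G_2$), and mutation Dynkin if it is mutation equivalent to a Dynkin one. An integer skew-symmetrizable matrix is of Dynkin type $\Delta$ if its diagram (same rule) is $\Delta$. **Cartan counterpart and roots.** $C(B)=(c_{ij})$ with $c_{ii}=2$ and, for $i\ne j$ and $b_{ij}=a+bt$, $c_{ij}=|a|-|b|$. $V_B$ is the real vector space with basis $S_B=\{\alpha_1,\dots,\alpha_n\}$ (formal simple roots); $s_i:V_B\to V_B$ is linear with $s_i(\alpha_j)=\alpha_j-c_{ij}\alpha_i$; $W_B=\langle s_1,\dots,s_n\rangle$; $\Phi_B=W_B\cdot S_B$. The inner product on $V_B$ is $(u,v)=u^TDC(B)v$ in the basis $S_B$, and $\beta^\vee=2\beta/(\beta,\beta)$; so $(\alpha_i,\alpha_j^\vee)=c_{ji}$. **Mutation of roots.** For a gss matrix $A$ with simple roots $\alpha_i$ and $A'=\mu_k(A)$ with simple roots $\alpha'_i$, $\rho_k:\Phi_{A'}\to\Phi_A$ is the restriction of the linear map $V_{A'}\to V_A$ with $\alpha'_i\mapsto s_k(\alpha_i)$ if $\operatorname{sgn}(a_{ik})=1$ (i.e. there is an arrow $i\to k$ in the quiver of $A$) and $\alpha'_i\mapsto\alpha_i$ otherwise. In the composite $\rho$, the factor $\rho_{k_p}$ is the map $\Phi_{B^{(p)}}\to\Phi_{B^{(p-1)}}$, where $B^{(p)}=\mu_{k_p}\cdots\mu_{k_1}B_\Delta$.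 The pairing $(\gamma_j,\gamma_i^\vee)$ is that of $V_{B_\Delta}$. *)

(* Defs.v *)
From mathcomp Require Import all_boot all_order all_algebra.
From mathcomp Require Import reals.

Set Implicit Arguments.
Unset Strict Implicit.
Unset Printing Implicit Defensive.

Import Order.TTheory GRing.Theory Num.Theory.

Local Open Scope ring_scope.

(** * Gss matrices *)

Definition t2m1 : {poly int} := 'X^2 - 1.

(* [{poly %/ h}] quotients by [mk_monic h], which silently replaces [h] by
   ['X] unless [h] is monic of positive degree; this is not the case here. *)
Lemma mk_monic_t2m1 : mk_monic t2m1 = t2m1.
Proof.
have sX : size ('X^2 : {poly int}) = 3%N by rewrite size_polyXn.
have lt1 : (size (- 1 : {poly int})%R < size ('X^2 : {poly int}))%N.
  by rewrite sX size_polyN size_poly1.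
rewrite /mk_monic /t2m1 size_polyDl // sX /= monicE.
by rewrite lead_coefDl // lead_coefXn eqxx.
Qed.

Notation Zt := {poly %/ t2m1}.

Definition t : Zt := in_qpoly t2m1 'X.

Lemma t_sqr : t * t = 1.
Proof.
have mon : t2m1 \is monic by rewrite -mk_monic_t2m1; apply: monic_mk_monic.
have sz : size t2m1 = 3%N.
  by rewrite /t2m1 size_polyDl ?size_polyXn // size_polyN size_poly1.
apply/val_inj; rewrite /t -[in_qpoly _ _ * _]rmorphM /=.
rewrite /in_qpoly mk_monic_t2m1 /=.
rewrite -expr2 -[X in Pdiv.Ring.rmodp X _](subrK 1) -/t2m1.
rewrite Pdiv.RingMonic.rmodpD // Pdiv.RingMonic.rmodpp // add0r.
by rewrite Pdiv.CommonRing.rmodp_small ?npolypK ?sz ?size_poly1.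
Qed.

(* An element [b] of [Zt] is carried by its remainder, a polynomial of size at
   most 2, so that [b = a0 + a1 t] with the following [a0] and [a1]. *)
Definition part0 (b : Zt) : int := (b : {poly int})`_0.
Definition part1 (b : Zt) : int := (b : {poly int})`_1.

Definition sgn (b : Zt) : int := Num.sg (part0 b + part1 b).

Definition at1 (b : Zt) : int := (b : {poly int}).[1].

(* Used both over [Zt] (gss matrices) and over [int]. *)
Definition skew_symmetrizing (S : zmodType) n (d : 'I_n -> nat) (B : 'M[S]_n) :=
  (forall i, (0 < d i)%N) /\
  (forall i j, B i j *+ d i = - (B j i *+ d j)).

Definition skew_symmetrizable (S : zmodType) n (B : 'M[S]_n) :=
  exists d, skew_symmetrizing d B.

Definition gss n (B : 'M[Zt]_n) := skew_symmetrizable B.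

Definition mutate n (k : 'I_n) (B : 'M[Zt]_n) : 'M[Zt]_n :=
  \matrix_(i, j)
    let b := B i j in
    if (i == k) && (sgn b == 1) || (j == k) && (sgn b == -1) then - b
    else if (i == k) && (sgn b == -1) || (j == k) && (sgn b == 1) then - (t * b)
    else if sgn (B i k * B k j) == 1 then
      t * (b + (sgn (B i k))%:~R * B i k * B k j)
    else b.

(* [mutations [:: k1; ...; kl] B] is mu_{kl} ... mu_{k1} B: the head of the
   sequence is mutated first. *)
Fixpoint mutations n (ks : seq 'I_n) (B : 'M[Zt]_n) : 'M[Zt]_n :=
  if ks is k :: ks' then mutations ks' (mutate k B) else B.

Definition mutation_equivalent n (A B : 'M[Zt]_n) :=
  exists ks, B = mutations ks A \/ A = mutations ks B.

(** * Dynkin diagrams *)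

Inductive dynkin_type : Type :=
  | TypeA of nat | TypeB of nat | TypeC of nat | TypeD of nat | TypeE of nat
  | TypeF4 | TypeG2.

Definition dynkin_valid (X : dynkin_type) : bool :=
  match X with
  | TypeA n => 0 < n | TypeB n => 1 < n | TypeC n => 2 < n | TypeD n => 3 < n
  | TypeE n => 5 < n < 9 | TypeF4 => true | TypeG2 => true
  end%N.

Definition dynkin_rank (X : dynkin_type) : nat :=
  match X with
  | TypeA n | TypeB n | TypeC n | TypeD n | TypeE n => n
  | TypeF4 => 4 | TypeG2 => 2
  end.

Definition chain (n : nat) : seq (nat * nat * nat) :=
  [seq (i, i.+1, 1%N) | i <- iota 0 n.-1].

(* An item [(p, q, m)] stands for [m] edges joining [p] and [q]; if [m > 1] the
   multiple edge points from [p] to [q]. *)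
Definition dynkin_edges (X : dynkin_type) : seq (nat * nat * nat) :=
  match X with
  | TypeA n => chain n
  | TypeB n => rcons (chain n.-1) (n - 2, n - 1, 2)
  | TypeC n => rcons (chain n.-1) (n - 1, n - 2, 2)
  | TypeD n => rcons (chain n.-1) (n - 3, n - 1, 1)
  | TypeE n => rcons (chain n.-1) (2, n - 1, 1)
  | TypeF4 => [:: (0, 1, 1); (1, 2, 2); (2, 3, 1)]
  | TypeG2 => [:: (0, 1, 3)]
  end%N.

Definition dynkin_mult (X : dynkin_type) (p q : nat) : nat :=
  \sum_(e <- dynkin_edges X | (e.1 == (p, q)) || (e.1 == (q, p))) e.2.

Definition dynkin_larger (X : dynkin_type) (p q : nat) : bool :=
  has (fun e => (e.1 == (p, q)) && (1 < e.2)%N) (dynkin_edges X).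

(* The diagram of [M] (|m_ij m_ji| edges between i and j, with i > j iff
   |m_ij| > |m_ji|) is the Dynkin diagram [X], up to the naming of vertices. *)
Definition has_diagram n (M : 'M[int]_n) (X : dynkin_type) :=
  exists2 f : 'I_n -> 'I_(dynkin_rank X), bijective f &
    forall i j, i != j ->
      absz (M i j * M j i) = dynkin_mult X (f i) (f j) /\
      (`|M j i| < `|M i j|) = dynkin_larger X (f i) (f j).

Definition pure n (B : 'M[Zt]_n) :=
  forall i j, exists a : int, B i j = a%:~R \/ B i j = t * a%:~R.

Definition gss_dynkin n (X : dynkin_type) (B : 'M[Zt]_n) :=
  [/\ dynkin_valid X, gss B, pure B & has_diagram (map_mx at1 B) X].

Definition mutation_dynkin n (B : 'M[Zt]_n) :=
  exists X (A : 'M[Zt]_n), gss_dynkin X A /\ mutation_equivalent A B.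

Definition int_dynkin n (X : dynkin_type) (Bt : 'M[int]_n) :=
  [/\ dynkin_valid X, skew_symmetrizable Bt & has_diagram Bt X].

Definition tmx n (Bt : 'M[int]_n) : 'M[Zt]_n := t *: map_mx intr Bt.

(** * Roots *)

Definition cartan n (B : 'M[Zt]_n) : 'M[int]_n :=
  \matrix_(i, j) if i == j then 2 else `|part0 (B i j)| - `|part1 (B i j)|.

(* V_B is 'cV[R]_n for every B, each simple root being identified with a vector
   of the standard basis; linear maps are matrices acting on the left. *)
Definition simple_root (R : realType) n (i : 'I_n) : 'cV[R]_n := delta_mx i 0.

(* The matrix of the linear map that sends the j-th simple root to [f j]. *)
Definition linear_ext (R : realType) n (f : 'I_n -> 'cV[R]_n) : 'M[R]_n :=
  \matrix_(i, j) f j i 0.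

Definition reflection (R : realType) n (B : 'M[Zt]_n) (i : 'I_n) : 'M[R]_n :=
  linear_ext (fun j => simple_root R j - (cartan B i j)%:~R *: simple_root R i).

Inductive weyl_group (R : realType) n (B : 'M[Zt]_n) : 'M[R]_n -> Prop :=
  | weyl_gen i : weyl_group B (reflection R B i)
  | weyl_one : weyl_group B 1%:M
  | weyl_mul u v : weyl_group B u -> weyl_group B v -> weyl_group B (u *m v)
  | weyl_inv u : weyl_group B u -> weyl_group B (invmx u).

Definition Phi (R : realType) n (B : 'M[Zt]_n) (b : 'cV[R]_n) : Prop :=
  exists w j, weyl_group B w /\ b = w *m simple_root R j.

Definition dotp (R : realType) n (d : 'I_n -> nat) (B : 'M[Zt]_n)
    (u v : 'cV[R]_n) : R :=
  (u^T *m diag_mx (\row_i (d i)%:R) *m map_mx intr (cartan B) *m v) 0 0.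

Definition coroot (R : realType) n (d : 'I_n -> nat) (B : 'M[Zt]_n)
    (b : 'cV[R]_n) : 'cV[R]_n :=
  (2 / dotp d B b b) *: b.

Definition rho1 (R : realType) n (k : 'I_n) (A : 'M[Zt]_n) : 'M[R]_n :=
  linear_ext (fun i => if sgn (A i k) == 1
                       then reflection R A k *m simple_root R i
                       else simple_root R i).

(* The linear map V_{mutations ks A} -> V_A underlying
   rho_{k1} ... rho_{kl} for ks = [:: k1; ...; kl]. *)
Fixpoint rho (R : realType) n (ks : seq 'I_n) (A : 'M[Zt]_n) : 'M[R]_n :=
  if ks is k :: ks' then rho1 R k A *m rho R ks' (mutate k A) else 1%:M.

Definition Zspan (V : zmodType) (P : V -> Prop) (v : V) : Prop :=
  exists m (s : m.-tuple V), (forall i, P (tnth s i)) /\ inIntSpan s v.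

Definition Zbasis (V : zmodType) n (L : V -> Prop) (g : 'I_n -> V) :=
  (forall v, L v <-> exists c : 'I_n -> int, v = \sum_i g i *~ c i) /\
  (forall c : 'I_n -> int, \sum_i g i *~ c i = 0 -> forall i, c i = 0).

(* [g] is a signed companion basis for [B] in the root system of [A], whose
   inner product is determined by [d]. *)
Definition signed_companion_basis (R : realType) n (d : 'I_n -> nat)
    (A B : 'M[Zt]_n) (g : 'I_n -> 'cV[R]_n) :=
  Zbasis (Zspan (Phi A)) g /\
  (\matrix_(i, j) dotp d A (g j) (coroot d A (g i))) = map_mx intr (cartan B).

(* Main.v *)
(* Let b be the integer matrix B(1) and c = C(B). Along a mutation sequence
   starting at t times a Dynkin matrix, two properties persist: D c is the Gram
   matrix of a positive definite form, and every chordless cycle of the quiver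
   of b is cyclically oriented (Barot-Geiss-Zelevinsky). Positivity forces
   every chordless cycle to be odd, i.e. the product of the -c_ij along it is
   negative; for a triangle this together with the orientation gives the signs
   and the bound |b_ij| <= |b_ik b_kj| which make C(mu_k B) the matrix of the
   form of B in the mutated roots. So each rho_k is an integral isometry that
   conjugates the reflections of mu_k B into W_B, and it carries simple roots
   to roots. Orientation persists because mutating back at k turns a chordless
   cycle through k into one of B, and because for a chordless cycle avoiding k
   the arcs between the neighbours of k close up to cycles through k.
   A Dynkin gss matrix with entries in Z and tZ is reached from t Bt since the
   diagram is a tree and mutating twice at k multiplies row and column k by
   t. *)
From HB Require Import structures.
Require Import Defs.
From mathcomp Require Import all_boot all_order all_algebra.
From mathcomp Require Import reals.
From mathcomp Require Import zify ring.

Set Implicit Arguments.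
Unset Strict Implicit.
Unset Printing Implicit Defensive.

Import Order.TTheory GRing.Theory Num.Theory.

Local Open Scope ring_scope.

(** * Positive quasi-Cartan companions *)

(** The gss matrix is studied through two integer matrices: its values at t = 1, which mutate in the
    ordinary way, and its Cartan counterpart, whose signs record whether an entry lies in Z or in
    tZ. This requires pure entries, so purity belongs to the invariant [positive_oriented].
    Orientation and positivity have to be carried together: for a triangle that is not cyclically
    oriented, c_ij - c_ik c_kj need not have the absolute value of the mutated entry, and the proof
    that orientation persists uses that the forms before and after mutation are both positive. At
    the start, positivity comes from a vector u > 0 with C u > 0, and the off-diagonal Cartan
    entries are nonpositive, so oddness leaves no chordless cycle at all. All matrices are integral
    and are mapped to the reals only at the end; the isometry obtained is unimodular, which is the
    basis property. A signed mutation is not an involution, but its fourth power is the identity on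
    gss matrices; this is what lets mutation equivalence be read in both directions. *)

Definition posdef n (d : 'I_n -> nat) (c : 'M[int]_n) :=
  forall v : 'I_n -> int, (exists i, v i != 0) ->
    0 < \sum_i \sum_j v i * ((d i)%:Z * c i j) * v j.

Record companion n (d : 'I_n -> nat) (b c : 'M[int]_n) : Prop := Companion {
  companion_gt0 : forall i, (0 < d i)%N;
  companion_skew : forall i j, (d i)%:Z * b i j = - ((d j)%:Z * b j i);
  companion_diag : forall i, c i i = 2;
  companion_sym : forall i j, (d i)%:Z * c i j = (d j)%:Z * c j i;
  companion_abs : forall i j, i != j -> `|c i j| = `|b i j|;
  companion_posdef : posdef d c }.

(** Here [w1], [w2], [w3] are the products c_xy c_yx on the edges of a triangle and [p] is the
    product of the entries around it. Up to order the product of the weights is a square only for 1,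
    1, 1 and 1, 2, 2 and 1, 3, 3; the last inequality forces [p] to be nonnegative and excludes 1,
    3, 3. *)
Lemma weights3 (p w1 w2 w3 : int) : 0 < w1 < 4 -> 0 < w2 < 4 -> 0 < w3 < 4 ->
  p * p = w1 * w2 * w3 -> w1 + w2 + w3 < 4 + p -> 0 < p /\ w1 <= p.
Proof.
move=> h1 h2 h3 hp hs.
have H1 : w1 = 1 \/ w1 = 2 \/ w1 = 3 by lia.
have H2 : w2 = 1 \/ w2 = 2 \/ w2 = 3 by lia.
have H3 : w3 = 1 \/ w3 = 2 \/ w3 = 3 by lia.
have p6 : p < 6 by case: (ltP p 6) => // p6; have : 36 <= p * p; nia.
have : p = 0 \/ p = 1 \/ p = 2 \/ p = 3 \/ p = 4 \/ p = 5 by lia.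
move: hp hs; case: H1 => [->|[->|->]]; case: H2 => [->|[->|->]];
   case: H3 => [->|[->|->]] hp hs; case=> [|[|[|[|[|]]]]] e;
     rewrite e in hp hs *; lia.
Qed.

(** The inequalities assumed are the positive principal minors of orders 2 and 3 of the Gram matrix
    on x, y, z. Those of order 2 bound the edge weights by 3, and the determinant divided by 2 dx dy
    dz is the last inequality of [weights3]. Cancelling [|cyx|] in [w1 <= p] gives the bound. *)
Lemma cartan_triangle (dx dy dz cxy cyx cyz czy czx cxz : int) :
  0 < dx -> 0 < dy -> 0 < dz ->
  dx * cxy = dy * cyx -> dy * cyz = dz * czy -> dz * czx = dx * cxz ->
  cxy != 0 -> cyz != 0 -> czx != 0 ->
  0 < 4 * dx * dy - (dx * cxy) ^+ 2 ->
  0 < 4 * dy * dz - (dy * cyz) ^+ 2 ->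
  0 < 4 * dz * dx - (dz * czx) ^+ 2 ->
  0 < 8 * dx * dy * dz + 2 * (dx * cxy) * (dy * cyz) * (dz * czx)
     - 2 * dx * (dy * cyz) ^+ 2 - 2 * dy * (dz * czx) ^+ 2
     - 2 * dz * (dx * cxy) ^+ 2 ->
  0 < cxy * cyz * czx /\ `|cxy| <= `|cxz * czy|.
Proof.
move=> dx0 dy0 dz0 sxy syz szx xy0 yz0 zx0 mxy myz mzx det.
have e1 : (dx * cxy) ^+ 2 = dx * dy * (cxy * cyx) by rewrite expr2 {2}sxy; ring.
have e2 : (dy * cyz) ^+ 2 = dy * dz * (cyz * czy) by rewrite expr2 {2}syz; ring.
have e3 : (dz * czx) ^+ 2 = dz * dx * (czx * cxz) by rewrite expr2 {2}szx; ring.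
rewrite e1 in mxy; rewrite e2 in myz; rewrite e3 in mzx.
rewrite e1 e2 e3 in det.
have W (a b c : int) : 0 < a -> 0 < b -> 0 < 4 * a * b - a * b * c -> c < 4.
  by move=> a0 b0; rewrite (_ : _ - _ = a * b * (4 - c)) ?pmulr_rgt0 ?subr_gt0
    ?mulr_gt0 //; ring.
have w1 := W _ _ _ dx0 dy0 mxy; have w2 := W _ _ _ dy0 dz0 myz.
have w3 := W _ _ _ dz0 dx0 mzx.
have P (a b x y : int) : 0 < a -> 0 < b -> a * x = b * y -> x != 0 -> 0 < x * y.
  move=> a0 b0 e x0.
  have : 0 < a * b * (x * y).
    have -> : a * b * (x * y) = (a * x) ^+ 2 by rewrite expr2 {2}e; ring.
    by rewrite exprn_even_gt0 //= mulf_neq0 // gt_eqF.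
  by rewrite pmulr_rgt0 // mulr_gt0.
have v1 := P _ _ _ _ dx0 dy0 sxy xy0; have v2 := P _ _ _ _ dy0 dz0 syz yz0.
have v3 := P _ _ _ _ dz0 dx0 szx zx0.
have D0 : 0 < dx * dy * dz by rewrite !mulr_gt0.
have pp : cxy * cyz * czx = cyx * czy * cxz.
  apply: (mulfI (lt0r_neq0 D0)).
  have -> : dx * dy * dz * (cxy * cyz * czx) = (dx * cxy) * (dy * cyz) * (dz *
    czx) by ring.
  by rewrite sxy syz szx; ring.
have det' : 0 < (2 * (dx * dy * dz)) * (4 + cxy * cyz * czx - (cxy * cyx + cyz
  * czy + czx * cxz)).
  by apply: (lt_le_trans det); rewrite le_eqVlt; apply/orP; left; apply/eqP;
    ring.
rewrite pmulr_rgt0 ?subr_gt0 ?(mulr_gt0 _ D0) // in det'.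
have [p0 le1] : 0 < cxy * cyz * czx /\ cxy * cyx <= cxy * cyz * czx.
  apply: (@weights3 _ _ _ _ _ _ _ _ det'); try by rewrite ?v1 ?v2 ?v3.
  by rewrite {2}pp; ring.
split=> //.
have n0 : 0 < `|cyx| by rewrite normr_gt0; nia.
have := le1; rewrite pp -mulrA [cxy * cyx]mulrC -[cyx * cxy](ger0_norm) 1?mulrC
  ?(ltW v1) //.
rewrite -[cyx * (czy * cxz)]ger0_norm; last by rewrite mulrA -pp ltW.
by rewrite [cxy * cyx]mulrC !normrM ler_pM2l // mulrC.
Qed.

Lemma sum_support3 (V : nmodType) (I : finType) (F : I -> V) (x y z : I) :
  x != y -> y != z -> z != x ->
  (forall i, i != x -> i != y -> i != z -> F i = 0) ->
  \sum_i F i = F x + F y + F z.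
Proof.
move=> xy yz zx F0.
rewrite (bigD1 x) //= (bigD1 y) 1?eq_sym //= (bigD1 z) /=; last first.
  by rewrite zx eq_sym.
rewrite big1 ?addr0 ?addrA // => i /andP[/andP[ix iy] iz].
exact: F0.
Qed.

Section Companion.

Variables (n : nat) (d : 'I_n -> nat) (b c : 'M[int]_n).
Hypothesis bc : companion d b c.

Let dgt0 i : (0 < (d i)%:Z)%R.
Proof. by have := companion_gt0 bc i; lia. Qed.

Lemma companion_skew_diag i : b i i = 0.
Proof. have := companion_skew bc i i; have := dgt0 i; nia. Qed.

Lemma companion_skew_gt0 i j : (0 < b i j) = (b j i < 0).
Proof.
by have := companion_skew bc i j; have := dgt0 i; have := dgt0 j; nia.
Qed.

Lemma companion_eq0 i j : i != j -> (c i j == 0) = (b i j == 0).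
Proof. by move=> /(companion_abs bc); lia. Qed.

Lemma companion_skew_eq0 i j : (b i j == 0) = (b j i == 0).
Proof.
by have := companion_skew bc i j; have := dgt0 i; have := dgt0 j; nia.
Qed.

Lemma companion_sym_gt0 i j : (0 < c i j) = (0 < c j i).
Proof.
by have := companion_sym bc i j; have := dgt0 i; have := dgt0 j; nia.
Qed.

Lemma companion_sym_eq0 i j : (c i j == 0) = (c j i == 0).
Proof.
by have := companion_sym bc i j; have := dgt0 i; have := dgt0 j; nia.
Qed.

Lemma posdef3 x y z (p q r : int) :
  x != y -> y != z -> z != x -> r != 0 ->
  0 < p * p * ((d x)%:Z * 2) + q * q * ((d y)%:Z * 2) + r * r * ((d z)%:Z * 2)
      + 2 * p * q * ((d x)%:Z * c x y) + 2 * q * r * ((d y)%:Z * c y z)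
      + 2 * r * p * ((d z)%:Z * c z x).
Proof.
move=> xy yz zx r0.
pose v i : int := if i == x then p else if i == y then q else
  if i == z then r else 0.
have vx : v x = p by rewrite /v eqxx.
have vy : v y = q by rewrite /v eqxx eq_sym (negPf xy).
have vz : v z = r by rewrite /v eqxx (negPf zx) eq_sym (negPf yz).
have v0 i : i != x -> i != y -> i != z -> v i = 0.
  by rewrite /v => /negPf -> /negPf -> /negPf ->.
have vn : exists i, v i != 0 by exists z; rewrite vz.
have := companion_posdef bc vn.
rewrite (sum_support3 xy yz zx); last first.
  by move=> i *; rewrite big1 // => j _; rewrite v0 // !mul0r.
rewrite !(sum_support3 xy yz zx); do ?by move=> i *; rewrite (v0 i) // mulr0.
rewrite vx vy vz !(companion_diag bc).
have := companion_sym bc x y; have := companion_sym bc y z.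
have := companion_sym bc z x; set X := _ * _; set X' := _ * _ => <-.
by set Y := _ * _; set Y' := _ * _ => <-; set Z := _ * _;
  set Z' := _ * _ => <-; lia.
Qed.

Lemma companion_minor2 x y z : x != y -> y != z -> z != x ->
  0 < 4 * (d x)%:Z * (d y)%:Z - ((d x)%:Z * c x y) ^+ 2.
Proof.
move=> xy yz zx.
have dx0 : 2 * (d x)%:Z != 0 by have := dgt0 x; lia.
(* The coordinates at x and y form a column of the adjugate of their 2 x 2 Gram block, so the norm
   is the minor times 2 d_x. The coordinate at z is 0. *)
have := posdef3 0 (- ((d x)%:Z * c x y)) zx xy yz dx0.
set X := _ * c x y; set Z := _ * c z x; set Y := _ * c y z => h.
have {}h : 0 < (2 * (d x)%:Z) * (4 * (d x)%:Z * (d y)%:Z - X ^+ 2).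
  by apply: (lt_le_trans h); rewrite le_eqVlt; apply/orP; left; apply/eqP; ring.
by rewrite pmulr_rgt0 // in h; have := dgt0 x; lia.
Qed.

Lemma companion_triangle x y z : x != y -> y != z -> z != x ->
  c x y != 0 -> c y z != 0 -> c z x != 0 ->
  0 < c x y * c y z * c z x /\ `|c x y| <= `|c x z * c z y|.
Proof.
move=> xy yz zx xy0 yz0 zx0.
have mxy := companion_minor2 xy yz zx.
apply: (cartan_triangle (dgt0 x) (dgt0 y) (dgt0 z) (companion_sym bc _ _)
  (companion_sym bc _ _) (companion_sym bc _ _) xy0 yz0 zx0 mxy
  (companion_minor2 yz zx xy) (companion_minor2 zx xy yz) _).
pose X := (d x)%:Z * c x y; rewrite -/X in mxy.
pose Y := (d y)%:Z * c y z; pose Z := (d z)%:Z * c z x.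
(* Again a column of the adjugate, now of the 3 x 3 Gram matrix: its norm is the determinant times
   the minor on x and y. *)
have h := posdef3 (X * Y - 2 * (d y)%:Z * Z) (X * Z - 2 * (d x)%:Z * Y) xy yz zx
  (lt0r_neq0 mxy).
rewrite -/X -/Y -/Z in h *.
rewrite -(pmulr_rgt0 _ mxy); apply: (lt_le_trans h).
by rewrite le_eqVlt; apply/orP; left; apply/eqP; ring.
Qed.

End Companion.

(** * Chordless cycles *)

(* A chordless cycle of length [m] visits [w 0, ..., w (m - 1)] and closes up
   at [w m = w 0]. *)
Definition chordless n (b : 'M[int]_n) (m : nat) (w : nat -> 'I_n) :=
  [/\ (2 < m)%N, w m = w 0%N,
      forall i j, (i < j < m)%N -> w i != w j &
      forall i j, (i < j < m)%N ->
        (b (w i) (w j) != 0) = (j == i.+1) || (i == 0%N) && (j == m.-1)].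

(** Only the sign of [s] matters: it selects one of the two directions around the cycle. Admitting
    any integer allows an entry of the matrix as witness. *)
Definition oriented n (b : 'M[int]_n) (m : nat) (w : nat -> 'I_n) :=
  exists s : int, forall i, (i < m)%N -> 0 < s * b (w i) (w i.+1).

Definition cyclically_oriented n (b : 'M[int]_n) :=
  forall m w, chordless b m w -> oriented b m w.

Section Odd.

Variables (n : nat) (d : 'I_n -> nat) (b c : 'M[int]_n).
Hypothesis bc : companion d b c.

Lemma chordless_edge m w i : chordless b m w -> (i < m)%N ->
  w i != w i.+1 /\ b (w i) (w i.+1) != 0.
Proof.
case=> m2 wm winj adj im; have [im1|im1] := ltnP i.+1 m.
  by rewrite winj ?adj ?eqxx //; lia.
have -> : i.+1 = m by lia.
rewrite wm (companion_skew_eq0 bc) eq_sym winj ?adj ?eqxx; do ?lia.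
Qed.

Lemma chordless_edge_c m w i : chordless b m w -> (i < m)%N ->
  c (w i) (w i.+1) != 0.
Proof.
by move=> ch im; have [ne] := chordless_edge ch im; rewrite (companion_eq0 bc).
Qed.

Lemma sum_pushforward (T : finType) (m : nat) (w : 'I_m -> T) (e : 'I_m -> int)
    (h : T -> int) :
  \sum_x (\sum_(i | w i == x) e i) * h x = \sum_i e i * h (w i).
Proof.
under eq_bigr do rewrite big_distrl /=.
rewrite (exchange_big_dep xpredT) //=; apply: eq_bigr => i _.
by under eq_bigl do rewrite eq_sym; rewrite big_pred1_eq.
Qed.

(* Otherwise signs can be chosen along the cycle so that the signed sum of its
   basis vectors has nonpositive norm. *)
Lemma companion_odd m w : chordless b m w ->
  \prod_(i < m) - c (w i) (w i.+1) < 0.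
Proof.
move=> ch; have [m2 wm winj adj] := ch.
pose del i := \prod_(l < i) - c (w l) (w l.+1).
have delS i : del i.+1 = del i * - c (w i) (w i.+1).
  by rewrite /del big_ord_recr.
have del0 i : (i <= m)%N -> del i != 0.
  move=> im; apply/prodf_neq0 => l _; rewrite oppr_eq0.
  by apply: chordless_edge_c ch _; have := ltn_ord l; lia.
rewrite -/(del m) ltNge; apply/negP => dm.
have {dm} dm : 0 < del m by rewrite lt_def dm del0.
(* These signs are chosen to make each e_i c e_(i+1) negative along the path. Positivity of the full
   product, assumed for contradiction, is what makes them close up at [m]. *)
pose e i : int := sgz (del i).
have em : e m = e 0%N by rewrite /e gtr0_sgz // /del big_ord0.
have ee i : (i <= m)%N -> e i * e i = 1.
  by move=> im; rewrite /e; case: sgzP (del0 i im).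
pose nx i := if i.+1 == m then 0%N else i.+1.
have wnx i : w (nx i) = w i.+1 by rewrite /nx; case: eqP => // ->.
have enx i : e (nx i) = e i.+1 by rewrite /nx; case: eqP => // ->.
have E i : (i < m)%N -> e i * c (w i) (w (nx i)) * e (nx i) <= -1.
  move=> im; rewrite wnx enx [e i.+1]/e delS sgzM -/(e i).
  have := chordless_edge_c ch im; have := ee _ (ltnW im).
  move: (e i) (c _ _) => x y xx y0.
  have -> (z : int) : x * y * (x * z) = x * x * (y * z) by ring.
  by rewrite xx; case: sgzP; lia.
pose pr i := if i == 0%N then m.-1 else i.-1.
have nxpr i : (i < m)%N -> nx (pr i) = i by rewrite /nx /pr; case: eqP;
  case: eqP; lia.
have prm i : (i < m)%N -> (pr i < m)%N by rewrite /pr; case: eqP; lia.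
have E' i : (i < m)%N -> e i * c (w i) (w (pr i)) * e (pr i) <= -1.
  move=> im; have := E _ (prm _ im); rewrite nxpr //.
  have := ee _ (ltnW im); have := ee _ (ltnW (prm _ im)).
  have := companion_sym bc (w i) (w (pr i)).
  have := companion_gt0 bc (w i); have := companion_gt0 bc (w (pr i)).
  move: (e i) (e (pr i)) (c _ _) (c _ _) (d _) (d _) => x y c1 c2 d1 d2.
  move=> d10 d20 s x1 y1.
  have : x = 1 \/ x = -1 by nia.
  have : y = 1 \/ y = -1 by nia.
  by move=> [] -> [] ->; nia.
pose v x : int := \sum_(i < m | w i == x) e i.
have vn : exists x, v x != 0.
  exists (w 0%N); rewrite /v (big_pred1 (Ordinal (ltnW (ltnW m2)))); last first.
    move=> i; rewrite /= -[RHS](inj_eq val_inj) /=; have im := ltn_ord i.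
    have [-> | i0] := posnP i; first by rewrite !eqxx.
    by rewrite eq_sym (negPf (winj _ _ _)) ?i0 ?im // eq_sym eqn0Ngt i0.
  by rewrite /e /del big_ord0.
have := companion_posdef bc vn; rewrite ltNge => /negP; apply.
under eq_bigr => x _.
  under eq_bigr do rewrite -mulrA [_ * v _]mulrC.
  rewrite -big_distrr /= /v sum_pushforward; over.
rewrite sum_pushforward; apply: sumr_le0 => i _.
have im := ltn_ord i.
have nxm : (nx i < m)%N by rewrite /nx; case: eqP; lia.
(* Vertex i meets only itself and its two neighbours on the cycle; they contribute 2 d_i and twice
   at most - d_i. *)
rewrite (@sum_support3 _ _ _ i (Ordinal nxm) (Ordinal (prm _ im))); first last.
- move=> j; rewrite -!val_eqE /= => ji jnx jpr.
  suff -> : c (w i) (w j) = 0 by rewrite !mulr0.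
  have jm := ltn_ord j.
  apply/eqP; rewrite (companion_eq0 bc); last first.
    move: ji; rewrite neq_ltn => /orP[] ji; last by rewrite winj ?ji.
    by rewrite eq_sym winj ?ji.
  move: ji; rewrite neq_ltn => /orP[] ji.
    rewrite (companion_skew_eq0 bc) -[_ == 0]negbK adj ?ji //.
    by move: jnx jpr; rewrite /nx /pr; case: (i.+1 =P m); case: (_ i =P 0%N);
      lia.
  rewrite -[_ == 0]negbK adj ?ji //.
  by move: jnx jpr; rewrite /nx /pr; case: (i.+1 =P m); case: (_ i =P 0%N); lia.
- by rewrite -val_eqE /= /pr; case: (_ i =P 0%N); lia.
- by rewrite -val_eqE /= /pr /nx; case: (i.+1 =P m); case: (_ i =P 0%N); lia.
- by rewrite -val_eqE /= /nx; case: (i.+1 =P m); lia.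
rewrite /= (companion_diag bc).
have := E _ im; have := E' _ im; have := ee _ (ltnW im).
have := companion_gt0 bc (w i).
move: (e i) (e (nx i)) (e (pr i)) (c _ _) (c _ _) (d _) => x y z c1 c2 D.
move=> D0 xx h1 h2.
have -> : x * (x * (D%:Z * 2) + y * (D%:Z * c1) + z * (D%:Z * c2)) =
  D%:Z * (2 * (x * x) + x * c1 * y + x * c2 * z) by ring.
by rewrite xx pmulr_rle0; lia.
Qed.

End Odd.

(** * Mutation of positive companions *)

Definition mutate_int n (k : 'I_n) (b : 'M[int]_n) : 'M[int]_n :=
  \matrix_(i, j)
    if (i == k) || (j == k) then - b i j
    else if (0 < b i k) && (0 < b k j) then b i j + b i k * b k j
    else if (b i k < 0) && (b k j < 0) then b i j - b i k * b k j
    else b i j.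

(** The Gram matrix of the roots given by [root_mutation], with row i divided by d_i. Away from k,
    [b i k * b k j] is positive when exactly one of i, j has an arrow into k and the other one an
    arrow from k. If both roots are reflected, their pairing does not change. *)
Definition mutate_cartan n (k : 'I_n) (b c : 'M[int]_n) : 'M[int]_n :=
  \matrix_(i, j)
    if i == k then if 0 < b j k then - c i j else c i j
    else if j == k then if 0 < b i k then - c i j else c i j
    else if 0 < b i k * b k j then c i j - c i k * c k j
    else c i j.

Definition root_mutation n (k : 'I_n) (b c : 'M[int]_n) : 'M[int]_n :=
  1%:M - delta_mx k 0 *m (\row_j if 0 < b j k then c k j else 0).

Definition gram n (d : 'I_n -> nat) (c : 'M[int]_n) : 'M[int]_n :=
  \matrix_(i, j) ((d i)%:Z * c i j).

Lemma gram_form n (d : 'I_n -> nat) (c : 'M[int]_n) (v : 'cV_n) :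
  (v^T *m gram d c *m v) 0 0 = \sum_i \sum_j v i 0 * ((d i)%:Z * c i j) * v j 0.
Proof.
rewrite mxE exchange_big /=; apply: eq_bigr => j _.
by rewrite mxE big_distrl; apply: eq_bigr => i _; rewrite !mxE.
Qed.

(** The closed walk k, u 0, ..., u l, k of length l + 2, which closes a path up through k. *)
Definition cone n (k : 'I_n) (l : nat) (u : nat -> 'I_n) (i : nat) : 'I_n :=
  if (i == 0%N) || (l.+1 < i)%N then k else u i.-1.

Lemma cone0 n (k : 'I_n) l u : cone k l u 0 = k. Proof. by []. Qed.

Lemma coneS n (k : 'I_n) l u i : (i <= l)%N -> cone k l u i.+1 = u i.
Proof. by move=> il; rewrite /cone /= ltnNge ltnS il. Qed.

Lemma cone_last n (k : 'I_n) l u : cone k l u l.+2 = k.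
Proof. by rewrite /cone ltnSn. Qed.

Lemma cone_chordless n (b : 'M[int]_n) (k : 'I_n) l (u : nat -> 'I_n) :
  (0 < l)%N ->
  (forall i, (i <= l)%N -> u i != k) ->
  (forall i j, (i < j <= l)%N -> u i != u j) ->
  (forall i j, (i < j <= l)%N -> (b (u i) (u j) != 0) = (j == i.+1)) ->
  (forall i, (i <= l)%N -> (b k (u i) != 0) = (i == 0%N) || (i == l)) ->
  chordless b l.+2 (cone k l u).
Proof.
move=> l0 uk uu bu bk; split=> //.
- by rewrite cone_last.
- case=> [|i] [|j] // /andP[ij jl]; rewrite ?cone0 !coneS; do ?lia.
    by rewrite eq_sym uk //; lia.
  by apply: uu; lia.
- case=> [|i] [|j] // /andP[ij jl]; rewrite ?cone0 !coneS; do ?lia.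
    by rewrite bk; lia.
  by rewrite bu; lia.
Qed.

Section Mutation.

Variables (n : nat) (d : 'I_n -> nat) (b c : 'M[int]_n) (k : 'I_n).
Hypothesis bc : companion d b c.
Hypothesis co : cyclically_oriented b.

Let b' := mutate_int k b.
Let c' := mutate_cartan k b c.

Let dgt0 i : (0 < (d i)%:Z)%R.
Proof. by have := companion_gt0 bc i; lia. Qed.

(** An oriented path of length two joins x and y through k, in one direction or the other. Away from
    row and column k these are the entries that mutation changes. *)
Let pass x y := 0 < b x k * b k y.

Lemma mutate_int_l x : b' k x = - b k x.
Proof. by rewrite mxE eqxx. Qed.

Lemma mutate_int_r x : b' x k = - b x k.
Proof. by rewrite mxE eqxx orbT. Qed.

Lemma mutate_int_id x y : x != k -> y != k -> ~~ pass x y -> b' x y = b x y.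
Proof.
by rewrite mxE /pass => /negPf -> /negPf -> /=; case: ifP => [|_];
  [nia|case: ifP; nia].
Qed.

Lemma passE x y :
  pass x y = (0 < b x k) && (0 < b k y) || (b x k < 0) && (b k y < 0).
Proof.
rewrite /pass; case: (ltgtP 0 (b x k)) => [p | p | <-] /=.
- by rewrite pmulr_rgt0 // orbF.
- by rewrite nmulr_rgt0.
- by rewrite mul0r.
Qed.

Lemma pass_sym x y : pass x y = pass y x.
Proof.
rewrite /pass; have := companion_skew_gt0 bc x k;
  have := companion_skew_gt0 bc k x.
have := companion_skew_gt0 bc y k; have := companion_skew_gt0 bc k y.
move: (b x k) (b k x) (b y k) (b k y) => p q r s h1 h2 h3 h4.
by apply/idP/idP; nia.
Qed.

Lemma pass_neq x y : pass x y -> [/\ x != k, y != k & x != y].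
Proof.
rewrite /pass => p; have b0 := companion_skew_diag bc k.
split; apply: contraTneq p => e; rewrite e ?b0 ?mulr0 ?mul0r ?ltxx //.
have := companion_skew_gt0 bc y k; have := companion_skew_gt0 bc k y.
by move: (b y k) (b k y) => p q h1 h2; nia.
Qed.

(** Applied to the triangle k, x, y: its orientation gives the first conclusion, positivity the
    others. Thus both corrections are subtractions between numbers of equal sign, b_xy against the
    product through k and c_xy against c_xk c_ky, and the absolute values of the results still
    agree. *)
Lemma pass_triangle x y : pass x y -> b x y != 0 ->
  [/\ (0 < b x k) = (b x y < 0), `|b x y| <= `|b x k * b k y|,
      `|c x y| <= `|c x k * c k y| & 0 < c x y * (c x k * c k y)].
Proof.
move=> p bxy; have [xk yk xy] := pass_neq p.
have bxk : b x k != 0 by move: p; rewrite /pass; nia.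
have bky : b k y != 0 by move: p; rewrite /pass; nia.
have byx : b y x != 0 by rewrite (companion_skew_eq0 bc).
have bkx : b k x != 0 by rewrite (companion_skew_eq0 bc).
have byk : b y k != 0 by rewrite (companion_skew_eq0 bc).
have kx : k != x by rewrite eq_sym.
have ky : k != y by rewrite eq_sym.
have yx : y != x by rewrite eq_sym.
have [t1 t2] : 0 < c x y * c y k * c k x /\ `|c x y| <= `|c x k * c k y|.
  by apply: (companion_triangle bc); rewrite ?(companion_eq0 bc).
have [s os] : oriented b 3 (cone k 1 (fun i => if i == 0%N then x else y)).
  apply: co; apply: cone_chordless => //.
  - by case=> [|i] _ /=; rewrite eq_sym.
  - by case=> [|i] [|[|j]] //= /andP[].
  - by case=> [|i] [|[|j]] //= /andP[].
  - by case=> [|[|i]].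
have := os 0%N isT; have := os 1%N isT; have := os 2%N isT.
rewrite /cone /= => h1 h2 h3; split=> //.
- have := companion_skew_gt0 bc x k; have := companion_skew_gt0 bc k x.
  have := companion_skew_gt0 bc x y; move: h1 h2 h3 bxk bxy bkx byk.
  move: (b x k) (b k x) (b y k) (b x y) => p1 p2 p3 p4; clear; nia.
- by move: t2; rewrite !normrM !(companion_abs bc).
- have := companion_sym_gt0 bc x k; have := companion_sym_gt0 bc k y.
  have : c x k != 0 by rewrite (companion_eq0 bc).
  have : c k y != 0 by rewrite (companion_eq0 bc).
  have : c k x != 0 by rewrite (companion_eq0 bc).
  have : c y k != 0 by rewrite (companion_eq0 bc).
  move: t1; move: (c x k) (c k x) (c y k) (c k y) (c x y) => p1 p2 p3 p4 p5;
    clear.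
  nia.
Qed.

Lemma mutate_gram :
  gram d c' = (root_mutation k b c)^T *m gram d c *m root_mutation k b c.
Proof.
rewrite /root_mutation; set x := \row_j _; set G := gram d c.
have -> : (1%:M - delta_mx k 0 *m x)^T *m G *m (1%:M - delta_mx k 0 *m x) =
    G - x^T *m row k G - col k G *m x + x^T *m row k (col k G) *m x.
  have -> : (1%:M - delta_mx k 0 *m x)^T = 1%:M - x^T *m delta_mx 0 k.
    by rewrite [LHS]linearB /= trmx1 trmx_mul trmx_delta.
  rewrite mulmxBr mulmx1 !mulmxBl !mul1mx !rowE !colE !mulmxA.
  by rewrite opprB addrA addrAC.
apply/matrixP => i j; rewrite !(mxE, big_ord1).
have bkk := companion_skew_diag bc k; have ckk := companion_diag bc k.
have [-> | ik] := eqVneq i k.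
  have [-> | jk] := eqVneq j k; first by rewrite bkk ltxx; ring.
  by rewrite bkk ltxx ckk; case: ifP => _; ring.
have := companion_sym bc i k; set X := _ * c i k => Xs.
have [-> | jk] := eqVneq j k.
  by rewrite bkk ltxx ckk; case: ifP => _; rewrite ?mulrN -/X Xs; ring.
have ck0 l : l != k -> (b k l == 0) = (c k l == 0).
  by move=> lk; rewrite (companion_eq0 bc) // eq_sym.
have := ck0 _ ik; have := ck0 _ jk; rewrite ckk.
rewrite [b k i == 0](companion_skew_eq0 bc).
rewrite (companion_skew_gt0 bc j k).
move: Xs; have [-> | ci0] := eqVneq (c k i) 0;
  have [-> | cj0] := eqVneq (c k j) 0.
- by move=> _ /eqP -> /eqP ->; rewrite mul0r ltxx; ring.
- by move=> -> _ /eqP ->; rewrite mul0r !ltxx; case: ifP => _; ring.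
- by move=> _ /eqP -> _; rewrite mulr0 !ltxx; case: ifP => _; ring.
move=> Xs bj bi.
(* With all entries nonzero, and [b k j < 0] standing for an arrow j -> k, the product is positive
   iff exactly one of the two roots is reflected. When both are, the three correction terms cancel
   because c_kk = 2. *)
have -> : (0 < b i k * b k j) = ((0 < b i k) != (b k j < 0)).
  by move: bi bj; clear; nia.
by case: (0 < b i k); case: (b k j < 0) => /=; rewrite ?mulrBr ?mulrA -/X Xs;
  ring.
Qed.

(** The row vector has entry 0 at k, since b_kk = 0. Hence the rank one part N squares to zero and 1
    + N inverts 1 - N. *)
Lemma root_mutation_left_inverse :
  (1%:M + delta_mx k 0 *m (\row_j if 0 < b j k then c k j else 0)) *m
    root_mutation k b c = 1%:M.
Proof.
rewrite /root_mutation; set x := \row_j _.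
have xk : x *m delta_mx k 0 = 0 :> 'M_1.
  rewrite -colE; apply/matrixP => i j.
  by rewrite !mxE (companion_skew_diag bc) ltxx.
rewrite mulmxDl mul1mx mulmxBr mulmx1 -!mulmxA (mulmxA x) xk mul0mx mulmx0.
by rewrite subr0 subrK.
Qed.

(** Symmetry and positivity follow from the congruence [mutate_gram] by an invertible matrix. The
    equality of absolute values is where cyclic orientation enters, through [pass_triangle]. *)
Lemma mutate_companion : companion d b' c'.
Proof.
split.
- exact: companion_gt0 bc.
- move=> i j; have := companion_skew bc i j.
  have [-> | ik] := eqVneq i k; first by rewrite mutate_int_l mutate_int_r; lia.
  have [-> | jk] := eqVneq j k; first by rewrite mutate_int_l mutate_int_r; lia.
  rewrite !mxE (negPf ik) (negPf jk) /= => e.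
  have p : (d i)%:Z * (b i k * b k j) = (d j)%:Z * (b j k * b k i).
    rewrite mulrA (companion_skew bc) mulNr mulrAC (companion_skew bc k j).
    by rewrite mulNr opprK -mulrA.
  have -> : (0 < b j k) && (0 < b k i) = (b i k < 0) && (b k j < 0).
    by rewrite (companion_skew_gt0 bc k) (companion_skew_gt0 bc j) andbC.
  have -> : (b j k < 0) && (b k i < 0) = (0 < b i k) && (0 < b k j).
    by rewrite (companion_skew_gt0 bc k) (companion_skew_gt0 bc i) andbC.
  by do 2!case: ifP; nia.
- move=> i; have ii := companion_diag bc i.
  rewrite mxE; have [-> | ik] := eqVneq i k.
    by rewrite (companion_skew_diag bc) ltxx (companion_diag bc).
  have /negPf : ~~ pass i i by apply/negP => /pass_neq[_ _]; rewrite eqxx.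
  by rewrite /pass => ->.
- move=> i j; have := mutate_gram; set M := _ *m _ => e.
  have eG x y : (d x)%:Z * c' x y = M x y by rewrite -e [RHS]mxE.
  suff Ms : M^T = M by rewrite !eG -{1}Ms mxE.
  have Gs : (gram d c)^T = gram d c.
    by apply/matrixP => x y; rewrite !mxE (companion_sym bc).
  by rewrite /M !trmx_mul trmxK Gs mulmxA.
- move=> i j ij; rewrite !mxE; have := companion_abs bc ij.
  have [ik | ik] := eqVneq i k; first by case: ifP => _; rewrite ?normrN.
  have [jk | jk] := eqVneq j k; first by case: ifP => _; rewrite ?normrN.
  rewrite /= -/(pass i j) => e; case: ifP => p; last first.
    rewrite e; move/negbT: p; rewrite /pass.
    by case: ifP => [|_]; [nia|case: ifP => //; nia].
  have e2 : `|c i k * c k j| = `|b i k * b k j|.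
    by rewrite !normrM !(companion_abs bc) // eq_sym.
  have [b0 | bn] := eqVneq (b i j) 0.
    have -> : c i j = 0 by apply/eqP; rewrite (companion_eq0 bc) ?b0.
    rewrite b0 !add0r normrN e2.
    move: p; rewrite passE; case: (_ && _) => //= ->.
    by rewrite normrN.
  have [h1 h2 h3 h4] := pass_triangle p bn.
  have {h4} : (0 < c i j) && (0 < c i k * c k j) ||
      (c i j < 0) && (c i k * c k j < 0).
    move: h4; case: (ltgtP 0 (c i j)) => [?|?|<-]; last by rewrite mul0r.
      by rewrite pmulr_rgt0 // orbF.
    by rewrite nmulr_rgt0.
  have h1p : (0 < b i k) && (0 < b k j) -> b i j < 0 by rewrite h1 => /andP[].
  have {h1} h1n : (b i k < 0) && (b k j < 0) -> 0 < b i j by lia.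
  have q0 : 0 < b i k * b k j by [].
  move: p h1p h1n h2 h3 e e2 bn; rewrite passE.
  move: q0; move: (c i k * c k j) (b i k * b k j) => P q q0.
  by case: (_ && _) => //= [_ /(_ isT) + _|-> _ /(_ isT)]; lia.
- move=> v [i vi].
  have -> : \sum_i \sum_j v i * ((d i)%:Z * c' i j) * v j =
      ((\col_i v i)^T *m gram d c' *m \col_i v i) 0 0.
    rewrite gram_form; apply: eq_bigr => x _; apply: eq_bigr => y _.
    by rewrite !mxE.
  rewrite mutate_gram !mulmxA -trmx_mul -!mulmxA.
  set u := root_mutation k b c *m _; rewrite mulmxA gram_form.
  apply: (companion_posdef bc).
  have u0 : u != 0.
    apply/eqP => u0; have := congr1 (mulmx (1%:M + delta_mx k 0 *m
      (\row_j if 0 < b j k then c k j else 0))) u0.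
    rewrite /u mulmxA root_mutation_left_inverse mul1mx mulmx0.
    by move=> /matrixP/(_ i 0); rewrite !mxE => /eqP; rewrite (negPf vi).
  by have [x [y]] := matrix0Pn _ u0; rewrite ord1 => xy; exists x.
Qed.

End Mutation.

(** * Mutation preserves cyclic orientation *)

Definition rotate_cycle n (m : nat) (w : nat -> 'I_n) (i : nat) : 'I_n :=
  if i == m then w 1%N else w i.+1.

Lemma rotate_chordless n (d : 'I_n -> nat) (b c : 'M[int]_n) m w :
  companion d b c -> chordless b m w -> chordless b m (rotate_cycle m w).
Proof.
move=> bc [m2 wm winj adj]; rewrite /rotate_cycle; split=> //.
- by rewrite eqxx ifN //; lia.
- move=> i j /andP[ij jm]; rewrite !ifN; do ?lia.
  have [-> | jm1] := eqVneq j.+1 m; last by rewrite winj //; lia.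
  by rewrite wm eq_sym winj //; lia.
- move=> i j /andP[ij jm]; rewrite !ifN; do ?lia.
  have [e | jm1] := eqVneq j.+1 m; last by rewrite adj //; lia.
  rewrite e wm (companion_skew_eq0 bc) adj; lia.
Qed.

Lemma rotate_oriented n (b : 'M[int]_n) m w : chordless b m w ->
  oriented b m (rotate_cycle m w) -> oriented b m w.
Proof.
move=> [m2 wm _ _] [s os]; exists s => -[_|i im].
  have := os m.-1; rewrite /rotate_cycle ifN; last by lia.
  by rewrite prednK ?eqxx ?wm; [apply; lia | lia].
by have := os i; rewrite /rotate_cycle !ifN; [apply|..]; lia.
Qed.

(** Allows a cycle to be started at any of its vertices. The third clause carries over that the
    cycle avoids a given vertex. *)
Lemma rotate_to n (d : 'I_n -> nat) (b c : 'M[int]_n) m w i :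
  companion d b c -> chordless b m w -> (i < m)%N ->
  exists w', [/\ chordless b m w', w' 0%N = w i,
    (forall j, (j < m)%N -> exists2 l, (l < m)%N & w' j = w l) &
    oriented b m w' -> oriented b m w].
Proof.
move=> bc; elim: i w => [|i IH] w ch im.
  by exists w; split=> // j jm; exists j.
have ch1 := rotate_chordless bc ch.
have [w' [ch' w'0 w'l os]] := IH _ ch1 (ltnW im).
exists w'; split=> //.
- by rewrite w'0 /rotate_cycle ifN //; lia.
- move=> j jm; have [l lm ->] := w'l j jm; rewrite /rotate_cycle.
  have [_ wm _ _] := ch.
  case: ifP => lm'; first by exists 1%N => //; lia.
  have [lm1 | lm1] := eqVneq l.+1 m; first by exists 0%N;
    [lia | rewrite lm1 wm].
  by exists l.+1 => //; lia.
- by move=> /os; apply: rotate_oriented.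
Qed.

Lemma last_before (P : pred nat) j : P 0%N -> (0 < j)%N ->
  exists i, [/\ (i < j)%N, P i & forall l, (i < l < j)%N -> ~~ P l].
Proof.
move=> P0; elim: j => // j IH _.
have [Pj | Pj] := boolP (P j); first by exists j; split=> // l; lia.
have [j0 | j0] := posnP j; first by rewrite j0 P0 in Pj.
have [i [ij Pi Pl]] := IH j0; exists i; split=> //; first by lia.
move=> l /andP[il]; rewrite ltnS leq_eqVlt => /orP[/eqP -> //|lj].
by rewrite Pl // il.
Qed.

Lemma mulr_same_sign (s x y : int) : 0 < s * x -> 0 < s * y -> 0 < x * y.
Proof.
case: (ltgtP s 0) => [s0|s0|->]; last by rewrite mul0r ltxx.
  by rewrite 2?(nmulr_rgt0 _ s0) => x0 y0; rewrite nmulr_rgt0.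
by rewrite 2?(pmulr_rgt0 _ s0) => x0 y0; rewrite pmulr_rgt0.
Qed.

Section Orientation.

Variables (n : nat) (d : 'I_n -> nat) (b c : 'M[int]_n) (k : 'I_n).
Hypothesis bc : companion d b c.
Hypothesis co : cyclically_oriented b.

Let b' := mutate_int k b.
Let c' := mutate_cartan k b c.
Let bc' : companion d b' c' := mutate_companion k bc co.
Let pass x y := 0 < b x k * b k y.

Let bk'0 x : (b' k x == 0) = (b k x == 0).
Proof. by rewrite /b' mutate_int_l oppr_eq0. Qed.

Let pass_nbr x y : pass x y -> b k x != 0 /\ b k y != 0.
Proof.
rewrite /pass (companion_skew_eq0 bc k x) => p.
by split; apply: contraTneq p => ->; rewrite ?mulr0 ?mul0r ltxx.
Qed.

(** For x -> k -> y any arrow between x and y goes back to x, the triangle being oriented, and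
    mutation cancels it or outweighs it. So the arrow afterwards goes from x to y or is absent. *)
Lemma mutate_int_pass x y : pass x y ->
  [/\ 0 <= b x k * b' x y, b x k * b x y <= 0 & b x y = 0 -> b' x y != 0].
Proof.
move=> p; have [xk yk _] := pass_neq bc p.
have e : b' x y = if 0 < b x k then b x y + b x k * b k y
                  else b x y - b x k * b k y.
  rewrite /b' mxE (negPf xk) (negPf yk) /=; move: p; rewrite /pass passE.
  by case/orP=> /andP[h1 h2]; rewrite h1 h2 // ltNge (ltW h1).
have q0 : 0 < b x k * b k y by [].
have [b0 | bn] := eqVneq (b x y) 0.
  by rewrite e b0 mulr0 add0r sub0r; case: ifP => h; split=> //; nia.
have [h1 h2 _ _] := pass_triangle bc co p bn.
rewrite e h1; move: q0 h2; rewrite -h1; move: (b x k * b k y) => q q0 h2.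
have : b x k != 0 by apply: contraTneq p; rewrite /pass => ->;
  rewrite mul0r ltxx.
by case: ifP h1 => h h1 ?; split=> //; nia.
Qed.

(** The neighbours w 1 and w (m - 1) of k are joined by an oriented path through k: otherwise the
    cycle would be chordless in [b] too, and its orientation there would supply such a path. For m =
    3 the sign of the third edge is then known from [mutate_int_pass]. *)
Lemma oriented_through m w : chordless b' m w -> w 0%N = k -> oriented b' m w.
Proof.
move=> [m2 wm winj adj] w0.
have wk i : (0 < i < m)%N -> w i != k.
  by move=> im; rewrite eq_sym -w0 winj //; lia.
have nbr i : (0 < i < m)%N -> (b k (w i) != 0) = (i == 1%N) || (i == m.-1).
  by move=> im; rewrite -bk'0 -w0 adj //; lia.
have np i j : (0 < i < j)%N -> (j < m)%N -> (1 < i)%N || (j < m.-1)%N ->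
    ~~ pass (w i) (w j).
  move=> ij jm h; apply/negP => /pass_nbr[]; rewrite !nbr; lia.
have b'E i j : (0 < i < j)%N -> (j < m)%N -> (1 < i)%N || (j < m.-1)%N ->
    b' (w i) (w j) = b (w i) (w j).
  by move=> ij jm h; apply: mutate_int_id; rewrite ?wk ?np //; lia.
have [p | p] := boolP (pass (w m.-1) (w 1%N)); last first.
  have ch : chordless b m w.
    split=> // i j ij; rewrite -adj //.
    have [i0 | i0] := posnP i; first by rewrite i0 w0 bk'0.
    have [/andP[/eqP -> /eqP ->] | e] := boolP ((i == 1%N) && (j == m.-1)).
      rewrite /b' mutate_int_id ?wk //; try lia.
      by rewrite (pass_sym k bc).
    by rewrite b'E //; lia.
  have [s os] := co ch; have h0 := os 0%N; have h1 := os m.-1.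
  rewrite prednK ?wm ?w0 in h0 h1; last by lia.
  move/negP: p; case; rewrite /pass.
  have {}h0 := h0 (ltnW (ltnW m2));
    have {}h1 : 0 < s * b (w m.-1) k by apply: h1; lia.
  by move: h0 h1; move: (b _ _) (b _ _) => x y; clear; nia.
have [p1 p2 p3] := mutate_int_pass p.
have nyk : b (w m.-1) k != 0 by rewrite (companion_skew_eq0 bc) nbr ?eqxx ?orbT
  //; lia.
exists (- b (w m.-1) k) => i im.
have [-> | i0] := posnP i; first by rewrite w0 /b' mutate_int_l mulrNN.
have [e | im1] := eqVneq i m.-1.
  rewrite e prednK ?wm ?w0 /b' ?mutate_int_r ?mulrNN; last by lia.
  by rewrite -expr2 exprn_even_gt0.
have [m3 | m3] := eqVneq m 3.
  have i1 : i = 1%N by lia.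
  rewrite i1; have := adj 1%N 2; rewrite m3 /= in p1 nyk * => /(_ isT) h.
  have := companion_skew_gt0 bc' (w 1%N) (w 2);
    have := companion_skew_gt0 bc' (w 2) (w 1%N).
  have := companion_skew_eq0 bc' (w 1%N) (w 2).
  move: p1 nyk h; move: (b _ _) (b' _ _) (b' _ _) => x y z; clear; nia.
have b'0 : b' (w m.-1) (w 1%N) = 0.
  by apply/eqP; rewrite (companion_skew_eq0 bc') -[_ == 0]negbK adj; lia.
have bn : b (w m.-1) (w 1%N) != 0 by apply/eqP => /p3; rewrite b'0.
(* For m > 3 the two neighbours of k are not joined in [b'], so an arrow between them in [b] was
   cancelled. Leaving out k gives a chordless cycle of [b] of length m - 1, whose orientation is
   used. *)
pose v i := if i == m.-1 then w 1%N else w i.+1.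
have ch : chordless b m.-1 v.
  rewrite /v; split.
  - by lia.
  - by rewrite eqxx ifN //; lia.
  - by move=> x y xy; rewrite !ifN ?winj //; lia.
  - move=> x y xy; rewrite !ifN; do ?lia.
    have [e | e] := boolP ((x == 0%N) && (y == m.-2)).
      by move/andP: e => [/eqP -> /eqP ->];
        rewrite prednK 1?(companion_skew_eq0 bc) ?bn; lia.
    by rewrite -b'E ?adj //; lia.
have [s os] := co ch.
have := os m.-2; rewrite /v ifN ?prednK ?eqxx; do ?lia;
  move=> /(_ (leqnn _)) h1.
have := os i.-1; rewrite /v !ifN ?prednK; do ?lia; move=> h2.
have {}h2 : 0 < s * b (w i) (w i.+1) by apply: h2; lia.
rewrite b'E; [|lia..].
move: h1 h2 p2 bn nyk; move: (b _ _) (b _ _) (b _ _) => x y z; clear; nia.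
Qed.

(** Only the closing edge can change. If mutation creates it, the cycle with k inserted is chordless
    in [b], hence oriented. If it is present before and after with a path through k, then the cycle
    is chordless in both matrices while exactly one factor of its product, c_xy against c_xy - c_xk
    c_ky, changes sign: it cannot be odd in both. *)
Lemma oriented_ends m w : chordless b' m w ->
  (forall i, (i < m)%N -> w i != k) ->
  (forall i, (0 < i < m.-1)%N -> b' k (w i) = 0) -> oriented b' m w.
Proof.
move=> ch wk nbr; have [m2 wm winj adj] := ch.
have np i j : (i < j < m)%N -> (0 < i)%N || (j < m.-1)%N ->
    ~~ pass (w i) (w j).
  move=> ij h; apply/negP => /pass_nbr[]; rewrite -!bk'0.
  have [i0 | i0] := posnP i; last by rewrite nbr ?eqxx //; lia.
  by move=> _; rewrite nbr ?eqxx //; lia.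
have b'E i j : (i < j < m)%N -> (0 < i)%N || (j < m.-1)%N ->
    b' (w i) (w j) = b (w i) (w j).
  by move=> ij h; apply: mutate_int_id; rewrite ?wk ?np //; lia.
have wk0 : w 0%N != k by apply: wk; lia.
have wkm : w m.-1 != k by apply: wk; lia.
have same i : (i < m.-1)%N -> b' (w i) (w i.+1) = b (w i) (w i.+1).
  by move=> im; apply: b'E; lia.
have [p | p] := boolP (pass (w m.-1) (w 0%N)); last first.
  have last_same : b' (w m.-1) (w 0%N) = b (w m.-1) (w 0%N).
    exact: mutate_int_id.
  have ch1 : chordless b m w.
    split=> // i j ij; rewrite -adj //.
    have [/andP[/eqP -> /eqP ->] | e] := boolP ((i == 0%N) && (j == m.-1)).
      by rewrite (companion_skew_eq0 bc') (companion_skew_eq0 bc) last_same.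
    by rewrite b'E //; lia.
  have [s os] := co ch1; exists s => i im.
  have [e | im1] := eqVneq i m.-1; last by rewrite same ?os //; lia.
  by have := os i im; rewrite e prednK ?wm ?last_same //; lia.
have [p1 p2 p3] := mutate_int_pass p.
have bn' : b' (w m.-1) (w 0%N) != 0.
  by rewrite (companion_skew_eq0 bc') adj ?eqxx ?orbT //; lia.
have [pk0 pkm] := pass_nbr p.
have [b0 | bn] := eqVneq (b (w m.-1) (w 0%N)) 0.
  have [s os] : oriented b m.-1.+2 (cone k m.-1 w).
    apply/co/cone_chordless.
    - by lia.
    - by move=> i im; apply: wk; lia.
    - by move=> i j ij; apply: winj; lia.
    - move=> i j ij.
      have [/andP[/eqP -> /eqP ->] | e] := boolP ((i == 0%N) && (j == m.-1)).
        by rewrite (companion_skew_eq0 bc) b0 eqxx; lia.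
      by rewrite -b'E ?adj //; lia.
    - move=> i im; have [-> //| i0] := eqVneq i 0%N.
      have [-> //| im1] := eqVneq i m.-1.
      by rewrite -bk'0 nbr ?eqxx //; lia.
  exists s => i im.
  have [e | im1] := eqVneq i m.-1; last first.
    by have := os i.+1; rewrite !coneS ?same; [apply|..]; lia.
  rewrite e prednK ?wm; last by lia.
  have := os m.-1.+1; rewrite cone_last coneS // => /(_ (leqnn _)) h.
  move: h p1 bn'; move: (b _ _) (b' _ _) => x y; clear; nia.
have ch1 : chordless b m w.
  split=> // i j ij; rewrite -adj //.
  have [/andP[/eqP -> /eqP ->] | e] := boolP ((i == 0%N) && (j == m.-1)).
    by rewrite (companion_skew_eq0 bc') (companion_skew_eq0 bc) bn bn'.
  by rewrite b'E //; lia.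
have [_ _ t1 t2] := pass_triangle bc co p bn.
have c'E : c' (w m.-1) (w 0%N) =
    c (w m.-1) (w 0%N) - c (w m.-1) k * c k (w 0%N).
  by move: p; rewrite mxE (negPf wk0) (negPf wkm) /pass => ->.
have csame i : (i < m.-1)%N -> c' (w i) (w i.+1) = c (w i) (w i.+1).
  move=> im; rewrite mxE !(negPf (wk _ _)) ?ifN //; try lia.
  by apply: np; lia.
have := companion_odd bc ch1; have := companion_odd bc' ch.
rewrite -(prednK (ltnW (ltnW m2))) !big_ord_recr /= prednK ?wm; last by lia.
rewrite c'E; under eq_bigr do rewrite csame //.
move: t1 t2; move: (\prod_i _) (c _ _) (c _ k * _) => P x y.
clear; move=> t1 t2 h1 h2.
have : 0 < P * P * (x * (x - y)).
  have -> : P * P * (x * (x - y)) = (P * - (x - y)) * (P * - x) by ring.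
  by rewrite nmulr_rgt0.
rewrite -expr2 pmulr_rgt0; first by nia.
by rewrite exprn_even_gt0 //=; apply: contraTneq h2 => ->; rewrite mul0r ltxx.
Qed.

(* The neighbours of [k] cut the cycle into arcs, each of which closes up to a
   chordless cycle through [k]: these cycles are oriented, so the edges at [k]
   alternate, and odd, so the whole cycle would be even. *)
Lemma chordless_neighbors m w : chordless b' m w ->
  (forall i, (i < m)%N -> w i != k) -> b' k (w 0%N) != 0 ->
  (exists2 j, (1 < j < m)%N & b' k (w j) != 0) ->
  (exists2 j, (0 < j < m.-1)%N & b' k (w j) != 0) -> False.
Proof.
move=> ch wk nb0 [j1 j1m nb1] [j2 j2m nb2]; have [m2 wm winj adj] := ch.
pose nb i := b' k (w i) != 0.
pose del i := \prod_(l < i) - c' (w l) (w l.+1).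
have del0 i : (i <= m)%N -> del i != 0.
  move=> im; apply/prodf_neq0 => l _; rewrite oppr_eq0.
  by apply: (chordless_edge_c bc' ch); have := ltn_ord l; lia.
have arc i j : (i < j <= m)%N -> nb i -> nb j ->
    (forall l, (i < l < j)%N -> ~~ nb l) ->
    b' k (w i) * b' k (w j) < 0 /\
    del i * del j * (c' k (w i) * c' k (w j)) < 0.
  move=> ij nbi nbj nbl.
  (* The arc has to be an induced path of the cycle, so its ends must neither coincide nor be joined
     by the edge outside the arc. The further neighbours [j1] and [j2] of k interrupt the arcs for
     which this would fail. *)
  have n0m : ~~ ((i == 0%N) && (m.-1 <= j)%N).
    apply/negP => /andP[/eqP i0 jm].
    by have := nbl j2; rewrite /nb nb2; lia.
  have n1m : ~~ ((i <= 1)%N && (j == m)).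
    apply/negP => /andP[i1 /eqP jm].
    by have := nbl j1; rewrite /nb nb1; lia.
  have ch1 : chordless b' (j - i).+2 (cone k (j - i) (fun l => w (i + l)%N)).
    apply: cone_chordless.
    - by lia.
    - move=> l lj; have [e | e] := eqVneq (i + l)%N m; last by apply: wk; lia.
      by rewrite e wm wk //; lia.
    - move=> x y xy; have [e | e] := eqVneq (i + y)%N m; last by apply: winj;
      lia.
      by rewrite e wm eq_sym winj //; lia.
    - move=> x y xy; have [e | e] := eqVneq (i + y)%N m; last by rewrite adj;
      lia.
      by rewrite e wm (companion_skew_eq0 bc') adj; lia.
    - move=> l lj; have [-> | l0] := eqVneq l 0%N; first by rewrite addn0.
      have [-> | lji] := eqVneq l (j - i)%N; first by rewrite subnKC //; lia.
      by apply/negbTE/nbl; lia.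
  have [s os] := oriented_through ch1 (cone0 _ _ _).
  have h1 := os 0%N isT; have := os (j - i).+1;
    rewrite cone_last !coneS // in h1 *.
  rewrite addn0 subnKC in h1 *; last by lia.
  move=> /(_ (leqnn _)) h2; split.
    have := mulr_same_sign h1 h2.
    case: (ltgtP (b' (w j) k) 0) => [h|h|->]; last by rewrite mulr0 ltxx.
      rewrite (nmulr_lgt0 _ h) => hi; rewrite (nmulr_rlt0 _ hi).
      by rewrite (companion_skew_gt0 bc').
    rewrite (pmulr_lgt0 _ h) => hi; rewrite (pmulr_rlt0 _ hi).
    by rewrite -(companion_skew_gt0 bc').
  have := companion_odd bc' ch1.
  rewrite big_ord_recl big_ord_recr /= cone0 coneS // addn0.
  rewrite /bump /= add1n coneS // cone_last subnKC; last by lia.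
  have dj : del j = del i * \prod_(l < j - i) - c' (w (i + l)%N) (w (i + l).+1).
    have ij' : (i <= j)%N by lia.
    by rewrite -{1}(subnKC ij') /del big_split_ord.
  under eq_bigr => l _.
    rewrite !coneS; [|by have := ltn_ord l; lia..].
    rewrite addnS; over.
  have := companion_sym_gt0 bc' (w j) k; have := companion_sym_eq0 bc' (w j) k.
  have := del0 i; rewrite dj; move: (del i) (\prod_(l < _) _) => D P.
  move: (c' _ _) (c' _ _) (c' _ _) => x y z D0 z0 z1 h.
  have {}D0 : 0 < D * D by rewrite -expr2 exprn_even_gt0 //= D0 //; lia.
  have e u : D * (D * P) * (x * u) = D * D * (P * (x * u)) by ring.
  rewrite e pmulr_rlt0 //.
  have {e} h : P * (x * z) < 0 by rewrite mulrN mulNr mulrN opprK mulrCA in h.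
  case: (ltgtP y 0) z0 z1 => [y0 | y0 | ->]; last first.
  - by move=> /eqP z0; rewrite z0 !mulr0 ltxx in h.
  - by move=> _ z0; move: h; rewrite !mulrA (pmulr_llt0 _ z0) (pmulr_llt0 _ y0).
  - move=> zn zp; have z0 : z < 0 by lia.
    by move: h; rewrite !mulrA (nmulr_llt0 _ z0) (nmulr_llt0 _ y0).
(* Each arc changes the sign of b' at k and the sign of [del] times c' at k, so this product stays
   positive from one neighbour to the next. At j = m it makes the product around the cycle positive,
   against [companion_odd]. *)
have ind j : (j <= m)%N -> nb j ->
    0 < del j * (c' k (w j) * b' k (w j)) * (c' k (w 0%N) * b' k (w 0%N)).
  elim/ltn_ind: j => j IH jm nbj; have [-> | j0] := posnP j.
    have c0 : c' k (w 0%N) != 0.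
      by rewrite (companion_eq0 bc') // eq_sym wk //; lia.
    rewrite /del big_ord0 mul1r -expr2 exprn_even_gt0 //=.
    by rewrite mulf_neq0.
  have [i [ij nbi nbl]] := @last_before nb j nb0 j0.
  have im : (i <= m)%N by lia.
  have [|h1 h2] := arc i j _ nbi nbj nbl; first by lia.
  apply: mulr_same_sign (IH i ij im nbi).
  have -> : del i * (c' k (w i) * b' k (w i)) * (del j * (c' k (w j) * b' k (w
    j))) =
    b' k (w i) * b' k (w j) * (del i * del j * (c' k (w i) * c' k (w j))) by
      ring.
  by rewrite nmulr_rgt0.
have := ind m (leqnn m); rewrite /nb wm => /(_ nb0).
rewrite -mulrA -expr2 pmulr_lgt0;
  first by rewrite ltNge ltW // (companion_odd bc' ch).
rewrite exprn_even_gt0 //= mulf_neq0 // (companion_eq0 bc') //.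
by rewrite eq_sym wk //; lia.
Qed.

(** The cases are: k lies on the cycle; k has no neighbour on it; all its neighbours are the two
    ends of a single edge, turned into the closing edge by a rotation; or there are too many
    neighbours for such a rotation, which is contradictory. *)
Lemma mutate_cyclically_oriented : cyclically_oriented b'.
Proof.
move=> m w ch; have [m2 _ _ _] := ch.
have [/existsP[i /eqP wi] | nk] := boolP [exists i : 'I_m, w i == k].
  have [w' [ch' w'0 _ os]] := rotate_to bc' ch (ltn_ord i).
  by apply/os/oriented_through; rewrite ?w'0.
have {nk} wk i : (i < m)%N -> w i != k.
  move=> im; apply: contra nk => wi; apply/existsP.
  by exists (Ordinal im).
have [/existsP[i nbi] | nn] := boolP [exists i : 'I_m, b' k (w i) != 0];
  last first.
  apply: oriented_ends => // i im; apply/eqP; apply: contraNT nn => nbi.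
  have im' : (i < m)%N by lia.
  by apply/existsP; exists (Ordinal im').
have [w' [ch' w'0 w'l os]] := rotate_to bc' ch (ltn_ord i); apply: os.
have {wk} wk j : (j < m)%N -> w' j != k.
  by move=> jm; have [l lm ->] := w'l j jm; apply: wk.
rewrite -w'0 in nbi; move: w' {w'0 w'l} ch' nbi wk => {ch i w}w ch nb0 wk.
have [/existsP[j /andP[jm nbj]] | nn] :=
    boolP [exists j : 'I_m, (0 < j < m.-1)%N && (b' k (w j) != 0)]; last first.
  apply: oriented_ends => // j jm; apply/eqP; apply: contraNT nn => nbj.
  have jm' : (j < m)%N by lia.
  by apply/existsP; exists (Ordinal jm'); rewrite /= jm.
have [/existsP[l /andP[l1 nbl]] | nn] :=
    boolP [exists l : 'I_m, (1 < l)%N && (b' k (w l) != 0)].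
  exfalso; apply: (chordless_neighbors ch wk nb0).
    by exists l; rewrite ?l1 ?ltn_ord.
  by exists j.
(* Here w 0 and w 1 alone can be neighbours of k; one more rotation makes them last and first. *)
apply/(rotate_oriented ch)/oriented_ends.
- exact: rotate_chordless bc' ch.
- move=> x xm; rewrite /rotate_cycle ifN; last by lia.
  have [e | e] := eqVneq x.+1 m; last by apply: wk; lia.
  by have [_ wm _ _] := ch; rewrite e wm wk //; lia.
move=> x xm; rewrite /rotate_cycle ifN; last by lia.
have xm' : (x.+1 < m)%N by lia.
apply/eqP; apply: contraNT nn => nbx; apply/existsP.
by exists (Ordinal xm'); rewrite /= nbx andbT; lia.
Qed.

End Orientation.

(** * The ring Z[t]/(t^2 - 1) *)

Lemma size_t2m1 : size t2m1 = 3%N.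
Proof. by rewrite /t2m1 size_polyDl ?size_polyXn // size_polyN size_poly1. Qed.

Lemma size_Zt (x : Zt) : (size (x : {poly int}) <= 2)%N.
Proof. by apply: leq_trans (size_npoly x) _;
  rewrite mk_monic_t2m1 size_t2m1. Qed.

Lemma Zt_eq (x y : Zt) : part0 x = part0 y -> part1 x = part1 y -> x = y.
Proof.
move=> e0 e1; apply/val_inj/polyP => -[|[|i]] //.
by rewrite !nth_default ?(leq_trans (size_Zt _)).
Qed.

Lemma part0_additive : zmod_morphism part0.
Proof. by move=> x y; rewrite /part0 -coefB. Qed.
HB.instance Definition _ := GRing.isZmodMorphism.Build _ _ part0 part0_additive.

Lemma part1_additive : zmod_morphism part1.
Proof. by move=> x y; rewrite /part1 -coefB. Qed.
HB.instance Definition _ := GRing.isZmodMorphism.Build _ _ part1 part1_additive.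

Lemma val_t : (t : {poly int}) = 'X.
Proof.
rewrite /t /=; move: (mk_monic_t2m1) => e.
by rewrite e Pdiv.CommonRing.rmodp_small // size_polyX size_t2m1.
Qed.

Lemma part0_int (a : int) : part0 a%:~R = a.
Proof. by rewrite raddfMz /= /part0 coefC intz. Qed.

Lemma part1_int (a : int) : part1 a%:~R = 0.
Proof. by rewrite raddfMz /= /part1 coefC mul0rz. Qed.

Lemma part0_t_int (a : int) : part0 (t * a%:~R) = 0.
Proof. by rewrite mulrzr raddfMz /= /part0 val_t coefX mul0rz. Qed.

Lemma part1_t_int (a : int) : part1 (t * a%:~R) = a.
Proof. by rewrite mulrzr raddfMz /= /part1 val_t coefX intz. Qed.

Lemma Zt_parts (x : Zt) : x = (part0 x)%:~R + t * (part1 x)%:~R.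
Proof.
by apply: Zt_eq; rewrite raddfD /= ?part0_int ?part0_t_int ?part1_int
  ?part1_t_int
  ?addr0 ?add0r.
Qed.

Lemma Zt_mul (x y : Zt) :
  x * y = (part0 x * part0 y + part1 x * part1 y)%:~R
        + t * (part0 x * part1 y + part1 x * part0 y)%:~R.
Proof.
rewrite {1}(Zt_parts x) {1}(Zt_parts y) !intrD !intrM.
have := t_sqr; move: t => s ss.
rewrite !mulrDl !mulrDr.
have -> : s * (part1 x)%:~R * (s * (part1 y)%:~R) =
   s * s * ((part1 x)%:~R * (part1 y)%:~R) by ring.
by rewrite ss mul1r; ring.
Qed.

Lemma part0M (x y : Zt) :
  part0 (x * y) = part0 x * part0 y + part1 x * part1 y.
Proof. by rewrite Zt_mul raddfD /= part0_int part0_t_int addr0. Qed.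

Lemma part1M (x y : Zt) :
  part1 (x * y) = part0 x * part1 y + part1 x * part0 y.
Proof. by rewrite Zt_mul raddfD /= part1_int part1_t_int add0r. Qed.

Lemma part0_t : part0 t = 0. Proof. by rewrite /part0 val_t coefX. Qed.
Lemma part1_t : part1 t = 1. Proof. by rewrite /part1 val_t coefX. Qed.

Lemma at1E x : at1 x = part0 x + part1 x.
Proof.
rewrite /at1 (horner_coef_wide _ (size_Zt x)) !big_ord_recl big_ord0 /=.
by rewrite !expr1n !mulr1 addr0.
Qed.

Lemma at1_additive : zmod_morphism at1.
Proof. by move=> x y; rewrite !at1E !raddfB /=; ring. Qed.
HB.instance Definition _ := GRing.isZmodMorphism.Build _ _ at1 at1_additive.

Lemma at1M x y : at1 (x * y) = at1 x * at1 y.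
Proof. by rewrite !at1E part0M part1M; ring. Qed.

Lemma at1_t : at1 t = 1. Proof. by rewrite at1E part0_t part1_t. Qed.

Lemma at1_int (a : int) : at1 a%:~R = a.
Proof. by rewrite at1E part0_int part1_int addr0. Qed.

Lemma sgnE x : sgn x = Num.sg (at1 x). Proof. by rewrite at1E. Qed.

Lemma sgn_eq1 x : (sgn x == 1) = (0 < at1 x).
Proof. by rewrite sgnE sgr_cp0. Qed.

Lemma sgn_eqN1 x : (sgn x == -1) = (at1 x < 0).
Proof. by rewrite sgnE sgr_cp0. Qed.

(** * Mutation of gss matrices *)

(** The pairs are the parts of b_ij, b_ik and b_kj, and w0 + w1 t is the new entry before its
    multiplication by t, which swaps the parts; hence [|w1| - |w0|]. When b_ij is nonzero, equal
    Cartan signs mean that b_ij and b_ik b_kj lie both in Z or both in tZ, so that the sum is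
    pure. *)
Lemma triangle_parts (x0 x1 y0 y1 z0 z1 : int) (s := Num.sg (y0 + y1)) :
  x0 * x1 = 0 -> y0 * y1 = 0 -> z0 * z1 = 0 ->
  0 < (y0 + y1) * (z0 + z1) ->
  (x0 + x1 != 0 ->
    [/\ (0 < y0 + y1) = (x0 + x1 < 0),
        `|x0 + x1| <= `|(y0 + y1) * (z0 + z1)| &
        0 < (`|x0| - `|x1|) * ((`|y0| - `|y1|) * (`|z0| - `|z1|))]) ->
  let w0 := x0 + s * (y0 * z0 + y1 * z1) in
  let w1 := x1 + s * (y0 * z1 + y1 * z0) in
  `|w1| - `|w0| = (`|x0| - `|x1|) - (`|y0| - `|y1|) * (`|z0| - `|z1|) /\
  w0 * w1 = 0.
Proof.
have cases (p q : int) : p * q = 0 -> p = 0 \/ q = 0.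
  by move/eqP; rewrite mulf_eq0 => /orP[] /eqP; [left | right].
move=> h1 h2 h3 h4 tri.
have ss : (0 < y0 + y1) && (s == 1) || (y0 + y1 < 0) && (s == -1).
  rewrite /s; case: (ltgtP 0 (y0 + y1)) h4 => [y|y|<-]; last by rewrite mul0r.
    by rewrite gtr0_sg.
  by rewrite ltr0_sg.
move: s ss h1 h2 h3 h4 tri => s ss.
move=> /cases[] ->; [move: x1 => x {x0}| move: x0 => x {x1}];
  move=> /cases[] y_0 /cases[] z_0; rewrite {}y_0 {}z_0 in ss *;
  rewrite ?(addr0, add0r, mulr0, mul0r, normr0, subr0, sub0r) in ss *;
  rewrite -?normrM ?(mulrN, mulNr, opprK) -?normrM;
  move: (_ * _) => P P0 tri.
all: have [x_0 | /tri[]] := eqVneq x 0; rewrite ?x_0 ?mulr0 ?mul0r ?add0r;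
  case/orP: ss => /andP[ys /eqP ->]; rewrite ?mul1r ?mulN1r ?normrN => *;
    split; lia.
Qed.

Lemma at1_mutate n (k : 'I_n) (B : 'M[Zt]_n) : at1 (B k k) = 0 ->
  map_mx at1 (mutate k B) = mutate_int k (map_mx at1 B).
Proof.
move=> bkk; apply/matrixP => i j; rewrite !mxE /= !sgn_eq1 !sgn_eqN1 at1M.
have s0 x : (0 < at1 x) = false -> (at1 x < 0) = false -> at1 x = 0.
  by move=> h1 h2; apply/eqP; rewrite eq_le !leNgt h1 h2.
have [ik | ik] := eqVneq i k; have [jk | jk] := eqVneq j k => /=.
- by rewrite ik jk bkk ltxx /= bkk oppr0.
- rewrite !orbF ik bkk mul0r ltxx; case: ifP => h1; first by rewrite raddfN.
  case: ifP => h2; first by rewrite raddfN /= at1M at1_t mul1r.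
  by rewrite s0 ?oppr0.
- rewrite jk bkk mulr0 ltxx; case: ifP => h1; first by rewrite raddfN.
  case: ifP => h2; first by rewrite raddfN /= at1M at1_t mul1r.
  by rewrite s0 ?oppr0.
rewrite sgnE; case: (ltgtP 0 (at1 (B i k))) => [h|h|h] /=.
- rewrite pmulr_rgt0 //; case: ifP => // _.
  by rewrite at1M at1_t mul1r raddfD /= !at1M at1_int gtr0_sg // mul1r.
- rewrite nmulr_rgt0 //; case: ifP => // _.
  rewrite at1M at1_t mul1r raddfD /= !at1M at1_int ltr0_sg //.
  by rewrite mulN1r mulNr.
- by rewrite -h mul0r ltxx.
Qed.

Definition pure_parts n (B : 'M[Zt]_n) :=
  forall i j, part0 (B i j) * part1 (B i j) = 0.

Lemma cartanE n (B : 'M[Zt]_n) i j : i != j ->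
  cartan B i j = `|part0 (B i j)| - `|part1 (B i j)|.
Proof. by move=> ij; rewrite mxE (negPf ij). Qed.

Section MutateGss.

Variables (n : nat) (d : 'I_n -> nat) (B : 'M[Zt]_n) (k : 'I_n).
Let b := map_mx at1 B.
Hypothesis Bp : pure_parts B.
Hypothesis bc : companion d b (cartan B).
Hypothesis co : cyclically_oriented b.

Let bE i j : b i j = at1 (B i j). Proof. by rewrite mxE. Qed.

Let B0 i j : at1 (B i j) = 0 -> B i j = 0.
Proof.
have := Bp i j; rewrite at1E => /eqP; rewrite mulf_eq0.
by case/orP=> /eqP e0; rewrite e0 ?add0r ?addr0 => e1; apply: Zt_eq;
  rewrite ?e0 ?e1 raddf0.
Qed.

(** On row and column k a factor t appears exactly for the arrows into k. It swaps the two parts and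
    so negates the Cartan entry, as reflecting the other root does. *)
Lemma mutate_parts i j : i != j ->
  cartan (mutate k B) i j = mutate_cartan k b (cartan B) i j /\
  part0 (mutate k B i j) * part1 (mutate k B i j) = 0.
Proof.
move=> ij; rewrite cartanE // [mutate_cartan _ _ _ _ _]mxE.
rewrite [mutate k B i j]mxE /= !sgn_eq1 !sgn_eqN1 at1M -!bE.
have s0 x y : (0 < b x y) = false -> (b x y < 0) = false -> B x y = 0.
  by move=> h1 h2; apply/B0/eqP; rewrite -bE eq_le !leNgt h1 h2.
have [ik | ik] := eqVneq i k; have [jk | jk] := eqVneq j k => /=.
- by rewrite ik jk eqxx in ij.
- have e : (0 < b j k) = (b i j < 0) by rewrite ik (companion_skew_gt0 bc).
  rewrite !orbF e ik (companion_skew_diag bc) mul0r ltxx -ik cartanE // bE.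
  case: (ltgtP 0 (at1 (B i j))) => h /=.
  + by rewrite !raddfN /= !normrN mulrNN Bp.
  + rewrite !raddfN /= !normrN mulrNN part0M part1M part0_t part1_t.
    by rewrite !mul0r !mul1r !add0r mulrC Bp opprB.
  + by rewrite B0 // !raddf0 normr0 mulr0.
- rewrite jk (companion_skew_diag bc) mulr0 ltxx -jk cartanE // bE.
  case: (ltgtP 0 (at1 (B i j))) => h /=.
  + rewrite !raddfN /= !normrN mulrNN part0M part1M part0_t part1_t.
    by rewrite !mul0r !mul1r !add0r mulrC Bp opprB.
  + by rewrite !raddfN /= !normrN mulrNN Bp.
  + by rewrite B0 // !raddf0 normr0 mulr0.
case: ifP => p; last by rewrite cartanE.
have kj : k != j by rewrite eq_sym.
have := triangle_parts (Bp i j) (Bp i k) (Bp k j).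
rewrite -!at1E -!bE -!cartanE //= => /(_ p) [bn|].
  by have [? ? _ ?] := pass_triangle bc co p bn; split.
rewrite sgnE !(part0M, part1M, part0_t, part1_t) !(mul0r, mul1r, add0r, addr0).
rewrite !raddfD /= -!mulrA !(part0M, part1M, part0_int, part1_int).
rewrite !(mul0r, add0r, addr0) -bE => -> e; split=> //.
by rewrite mulrC.
Qed.

Lemma mutate_diag i : mutate k B i i = 0.
Proof.
have Bii : B i i = 0 by apply: B0; rewrite -bE (companion_skew_diag bc).
rewrite mxE /= !sgn_eq1 !sgn_eqN1 at1M -!bE (companion_skew_diag bc) ltxx.
rewrite !andbF /= Bii ifN //.
by apply/negP => /(pass_neq bc)[_ _]; rewrite eqxx.
Qed.

Lemma mutate_pure_parts : pure_parts (mutate k B).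
Proof.
move=> i j; have [-> | ij] := eqVneq i j; last by have [] := mutate_parts ij.
by rewrite mutate_diag !raddf0 mul0r.
Qed.

Lemma cartan_mutate :
  cartan (mutate k B) = mutate_cartan k b (cartan B).
Proof.
apply/matrixP => i j; have [-> | ij] := eqVneq i j.
  by rewrite (companion_diag (mutate_companion k bc co)) mxE eqxx.
by have [] := mutate_parts ij.
Qed.

End MutateGss.

Definition positive_oriented n (d : 'I_n -> nat) (B : 'M[Zt]_n) :=
  [/\ pure_parts B, companion d (map_mx at1 B) (cartan B) &
      cyclically_oriented (map_mx at1 B)].

Lemma mutate_positive_oriented n (d : 'I_n -> nat) (B : 'M[Zt]_n) k :
  positive_oriented d B -> positive_oriented d (mutate k B).
Proof.
move=> [Bp bc co]; have bkk : at1 (B k k) = 0.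
  by have := companion_skew_diag bc k; rewrite mxE.
split; first exact: mutate_pure_parts Bp bc co.
  rewrite (cartan_mutate k Bp bc co) at1_mutate //.
  exact: mutate_companion.
rewrite at1_mutate //; exact: mutate_cyclically_oriented bc co.
Qed.

(** * Positivity of the Dynkin diagrams *)

(** The absolute value of the (p, q) entry of any matrix with this diagram. *)
Definition dynkin_weight X (p q : nat) : nat :=
  if dynkin_mult X p q == 0%N then 0%N
  else if dynkin_larger X p q then dynkin_mult X p q else 1%N.

Definition neighbors (N p q : nat) : bool :=
  (q == p.+1) && (q < N)%N || (p == q.+1) && (p < N)%N.

Lemma chain_mult N p q :
  (\sum_(e <- chain N | (e.1 == (p, q)) || (e.1 == (q, p))) e.2)%N =
  neighbors N p q.
Proof.
rewrite big_map /= /index_iota -[RHS]muln1.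
have [e | /negPf e] := boolP ((q == p.+1) && (q < N)%N).
  rewrite (eq_bigl (pred1 p)) => [|i]; last by rewrite /= !xpair_eqE; lia.
  rewrite -big_filter filter_pred1_uniq ?iota_uniq //;
    last by rewrite mem_iota; lia.
  by rewrite big_seq1 /neighbors e.
have [e' | /negPf e'] := boolP ((p == q.+1) && (p < N)%N).
  rewrite (eq_bigl (pred1 q)) => [|i]; last by rewrite /= !xpair_eqE; lia.
  rewrite -big_filter filter_pred1_uniq ?iota_uniq //;
    last by rewrite mem_iota; lia.
  by rewrite big_seq1 /neighbors e' orbT.
rewrite /neighbors e e' big_seq_cond big_pred0 // => i.
by rewrite mem_iota /= !xpair_eqE; lia.
Qed.

Lemma chain_larger N p q :
  has (fun e => (e.1 == (p, q)) && (1 < e.2)%N) (chain N) = false.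
Proof. by apply/hasP => -[_ /mapP[i _ ->]] /=; rewrite andbF. Qed.

Lemma neighbors_sum N n p (U : nat -> nat) :
  (\sum_(q < n) neighbors N p q * U q <=
   (p.+1 < N) * U p.+1 + (0 < p < N) * U p.-1)%N.
Proof.
have delta r : (\sum_(q < n) (val q == r) * U q <= U r)%N.
  have [rn | nr] := ltnP r n; last first.
    by rewrite big1 // => q _; rewrite ltn_eqF // (leq_trans (ltn_ord q)).
  rewrite (bigD1 (Ordinal rn)) //= eqxx mul1n big1 ?addn0 // => q.
  by rewrite -val_eqE /= => /negPf ->.
apply: (@leq_trans (\sum_(q < n) ((p.+1 < N) * ((val q == p.+1) * U q) +
    (0 < p < N) * ((val q == p.-1) * U q)))%N).
  apply: leq_sum => q _; rewrite !mulnA -mulnDl leq_mul2r /neighbors.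
  apply/orP; right; rewrite /= !mulnb; move: (nat_of_ord q) => x.
  by case: (x =P p.+1); case: (x =P p.-1); lia.
by rewrite big_split -!big_distrr leq_add //= leq_mul.
Qed.

Lemma chain_weight N X p q : dynkin_edges X = chain N ->
  dynkin_weight X p q = neighbors N p q /\ (dynkin_mult X p q <= 3)%N.
Proof.
move=> e; rewrite /dynkin_weight /dynkin_mult /dynkin_larger e.
by rewrite chain_mult chain_larger; case: (neighbors _ _ _).
Qed.

(** Types B, C, D and E are a chain on N vertices with one more edge. The bound on [maxn a b] says
    that this edge leaves the chain, so the two contributions do not overlap. *)
Lemma rcons_weight N a b m X p q : dynkin_edges X = rcons (chain N) (a, b, m) ->
  a != b -> (N <= maxn a b)%N -> (0 < m <= 3)%N ->
  dynkin_weight X p q =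
    (neighbors N p q + ((p == a) && (q == b)) * m + ((p == b) && (q == a)))%N /\
  (dynkin_mult X p q <= 3)%N.
Proof.
move=> e ab Nab m13; rewrite /dynkin_weight /dynkin_mult /dynkin_larger e.
rewrite has_rcons chain_larger -cats1 big_cat chain_mult /= big_mkcond big_seq1.
rewrite /= orbF !xpair_eqE [a == p]eq_sym [b == q]eq_sym [a == q]eq_sym [b ==
  p]eq_sym.
have ba : (b == a) = false by rewrite eq_sym (negPf ab).
have [/andP[/eqP -> /eqP ->] | /negPf pq] := boolP ((p == a) && (q == b)).
  have -> : neighbors N a b = false by rewrite /neighbors; lia.
  by rewrite ?ba ?(negPf ab) /=; case: m m13 {e} => [|[|[|[|]]]].
have [/andP[/eqP pb /eqP qa] | /negPf qp] := boolP ((p == b) && (q == a)).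
  have -> : neighbors N p q = false by rewrite /neighbors; lia.
  by rewrite pb qa ?eqxx ?ba ?(negPf ab) /=; case: m m13 {e} => [|[|[|[|]]]].
rewrite andbC in qp; rewrite qp /=.
by case: (neighbors N p q).
Qed.

Lemma rcons_weight_sum N a b m X p (U : nat -> nat) n :
  dynkin_edges X = rcons (chain N) (a, b, m) ->
  a != b -> (N <= maxn a b)%N -> (0 < m <= 3)%N -> (a < n)%N -> (b < n)%N ->
  (\sum_(q < n) dynkin_weight X p q * U q <=
   (p.+1 < N) * U p.+1 + (0 < p < N) * U p.-1
   + (p == a) * (m * U b) + (p == b) * U a)%N.
Proof.
move=> e ab Nab m13 an bn.
rewrite (eq_bigr (fun q : 'I_n => neighbors N p q * U q +
   (p == a) * m * ((val q == b) * U q) + (p == b) * ((val q == a) * U q))%N).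
  rewrite !big_split -!big_distrr /= !leq_add ?neighbors_sum //.
    rewrite (bigD1 (Ordinal bn)) //= eqxx mul1n big1 ?addn0 ?mulnA // => q.
    by rewrite -val_eqE /= => /negPf ->.
  rewrite (bigD1 (Ordinal an)) //= eqxx mul1n big1 ?addn0 // => q.
  by rewrite -val_eqE /= => /negPf ->.
move=> q _; have [-> _] := rcons_weight p q e ab Nab m13.
by rewrite /= -!mulnb; lia.
Qed.

(* Multiples of the coefficients of the half-sum of the positive roots, which
   pairs to 1 with every simple coroot. *)
Definition dynkin_height (X : dynkin_type) (p : nat) : nat :=
  match X with
  | TypeA n => p.+1 * (n - p)
  | TypeB n => if p == n.-1 then n * n.+1 else 2 * (p.+1 * (2 * n - p))
  | TypeC n => p.+1 * (2 * n - 1 - p)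
  | TypeD n => if (n.-2 <= p)%N then n * n.-1 else 2 * (p.+1 * (2 * n - 2 - p))
  | TypeE 6 => nth 1 [:: 16; 30; 42; 30; 16; 22] p
  | TypeE 7 => nth 1 [:: 34; 66; 96; 75; 52; 27; 49] p
  | TypeE _ => nth 1 [:: 92; 182; 270; 220; 168; 114; 58; 136] p
  | TypeF4 => nth 1 [:: 22; 42; 30; 16] p
  | TypeG2 => nth 1 [:: 10; 6] p
  end%N.

(** Positivity of the p-th coordinate of C u for the vector u of heights, written without
    subtraction: the diagonal entry is 2 and the weights are the negated off-diagonal entries. *)
Definition dominant X p :=
  (0 < dynkin_height X p)%N /\
  (\sum_(q < dynkin_rank X) dynkin_weight X p q * dynkin_height X q
    < 2 * dynkin_height X p)%N.

Lemma dominantA n p : (p < n)%N -> dominant (TypeA n) p.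
Proof.
move=> pn; split; first by rewrite /=; nia.
rewrite (eq_bigr (fun q : 'I_n => neighbors n p q * (q.+1 * (n - q)))%N).
  apply: leq_ltn_trans (neighbors_sum n n p (fun q => q.+1 * (n - q))%N) _.
  by rewrite /=; case: p pn => [|p] pn; case: ltnP => h; nia.
by move=> q _; have [-> _] := chain_weight p q (erefl (dynkin_edges (TypeA n))).
Qed.

Lemma dominantB n p : (p < n.+2)%N -> dominant (TypeB n.+2) p.
Proof.
move=> pn; rewrite /dominant; set U := dynkin_height (TypeB n.+2).
have lastU : U n.+1 = (n.+2 * n.+3)%N by rewrite /U /= eqxx.
have initU r : (r <= n)%N -> U r = (2 * (r.+1 * (2 * n.+2 - r)))%N.
  by move=> rn; rewrite /U /= ifN //; lia.
split; first by have [->|pn1] := eqVneq p n.+1; rewrite ?lastU ?initU; nia.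
have h := @rcons_weight_sum n.+1 n n.+1 2 (TypeB n.+2) p U n.+2.
apply: leq_ltn_trans (h _ _ _ _ _ _) _; try lia.
  by rewrite /= !subSS !subn0.
have [->|pn1] := eqVneq p n.+1.
  have -> : (n.+2 < n.+1)%N = false by lia.
  have -> : (0 < n.+1 < n.+1)%N = false by lia.
  have -> : (n.+1 == n) = false by lia.
  rewrite /= !mul0n !add0n mul1n lastU initU //.
  have -> : (2 * n.+2 - n)%N = n.+4 by lia.
  by nia.
have [->|pn0] := eqVneq p n.
  rewrite ltnn; case: (n) (lastU) (initU) => [|k] l i; rewrite l !i //=; nia.
have pn' : (p < n)%N by lia.
rewrite !mul0n !addn0 [U p]initU; last by lia.
rewrite [U p.+1]initU //.
case: (p) pn' => [|k] pn' /=; first by nia.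
have Uk : U k = (2 * (k.+1 * (2 * n.+2 - k)))%N by apply: initU; lia.
by rewrite Uk; nia.
Qed.

Lemma dominantC n p : (p < n.+2)%N -> dominant (TypeC n.+2) p.
Proof.
move=> pn; rewrite /dominant; set U := dynkin_height (TypeC n.+2).
have UE r : U r = (r.+1 * (2 * n.+2 - 1 - r))%N by [].
split; first by rewrite UE; nia.
have h := @rcons_weight_sum n.+1 n.+1 n 2 (TypeC n.+2) p U n.+2.
apply: leq_ltn_trans (h _ _ _ _ _ _) _; try lia.
  by rewrite /= !subSS !subn0.
have [->|pn1] := eqVneq p n.+1.
  have -> : (n.+2 < n.+1)%N = false by lia.
  have -> : (0 < n.+1 < n.+1)%N = false by lia.
  have -> : (n.+1 == n) = false by lia.
  by rewrite !UE; nia.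
have [->|pn0] := eqVneq p n.
  by rewrite ltnn !UE; case: (n) => [|k] /=; nia.
have pn' : (p < n)%N by lia.
by rewrite !mul0n !addn0 !UE; case: (p) pn' => [|k] pn' /=; nia.
Qed.

Lemma dominantD n p : (p < n.+3)%N -> dominant (TypeD n.+3) p.
Proof.
move=> pn; rewrite /dominant; set U := dynkin_height (TypeD n.+3).
have lastU r : (n < r)%N -> U r = (n.+3 * n.+2)%N by move=> rn;
  rewrite /U /= rn.
have initU r : (r <= n)%N -> U r = (2 * (r.+1 * (2 * n.+3 - 2 - r)))%N.
  by move=> rn; rewrite /U /= ltnNge rn.
split; first by have [pn1|pn1] := ltnP n p; [rewrite lastU | rewrite initU //;
  nia].
have h := @rcons_weight_sum n.+2 n n.+2 1 (TypeD n.+3) p U n.+3.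
apply: leq_ltn_trans (h _ _ _ _ _ _) _; try lia.
  by rewrite /= !subSS !subn0.
have [pn1|pn1] := ltnP n p.
  rewrite [U p]lastU //.
  have [e|e] := eqVneq p n.+1.
    rewrite e; have -> : (n.+1 == n.+2) = false by lia.
    have -> : (n.+2 < n.+2)%N = false by lia.
    have -> : (0 < n.+1 < n.+2)%N = true by lia.
    have -> : (n.+1 == n) = false by lia.
    rewrite /= !mul0n !addn0 mul1n initU //.
    have -> : (2 * n.+3 - 2 - n)%N = n.+4 by lia.
    by nia.
  have {e pn pn1} -> : p = n.+2 by lia.
  have -> : (n.+3 < n.+2)%N = false by lia.
  have -> : (0 < n.+2 < n.+2)%N = false by lia.
  have -> : (n.+2 == n) = false by lia.
  rewrite eqxx /= !mul0n !add0n mul1n initU //.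
  have -> : (2 * n.+3 - 2 - n)%N = n.+4 by lia.
  by nia.
have -> : (p == n.+2) = false by lia.
have -> : (p.+1 < n.+2)%N by lia.
have -> : (0 < p < n.+2)%N = (0 < p)%N by lia.
have [->|pn0] := eqVneq p n.
  rewrite [U n]initU // [U n.+1]lastU // [U n.+2]lastU //;
    case: (n) (initU) => [|k] i /=; first by nia.
  by rewrite i //; nia.
have pn' : (p < n)%N by lia.
rewrite [U p]initU // [U p.+1]initU //.
case: (p) pn' => [|k] pn' /=; first by nia.
have Uk : U k = (2 * (k.+1 * (2 * n.+3 - 2 - k)))%N by apply: initU; lia.
by rewrite Uk; nia.
Qed.

Lemma dominantE n p : (5 < n < 9)%N -> (p < n)%N -> dominant (TypeE n) p.
Proof.
move=> n6 pn; split.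
  by move: n6 pn; do 9?[case: n => [|n] //=]; do 9?[case: p => [|p] //=].
have h := @rcons_weight_sum n.-1 2 n.-1 1 (TypeE n) p (dynkin_height (TypeE n))
  n.
apply: leq_ltn_trans (h _ _ _ _ _ _) _; try lia; clear h.
  by rewrite /= subn1.
by move: n6 pn; do 9?[case: n => [|n] //=]; do 9?[case: p => [|p] //=].
Qed.

Lemma dominantF p : (p < 4)%N -> dominant TypeF4 p.
Proof.
rewrite /dominant /dynkin_weight /dynkin_mult /dynkin_larger /=.
rewrite !big_ord_recr big_ord0 /=.
by case: p => [|[|[|[|p]]]] // _; rewrite !big_cons !big_nil.
Qed.

Lemma dominantG p : (p < 2)%N -> dominant TypeG2 p.
Proof.
rewrite /dominant /dynkin_weight /dynkin_mult /dynkin_larger /=.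
rewrite !big_ord_recr big_ord0 /=.
by case: p => [|[|p]] // _; rewrite !big_cons !big_nil.
Qed.

Lemma dynkin_dominant X p :
  dynkin_valid X -> (p < dynkin_rank X)%N -> dominant X p.
Proof.
case: X => [n|n|n|n|n||] /= nX pn.
- exact: dominantA.
- by case: n nX pn => [|[|n]] // _; apply: dominantB.
- by case: n nX pn => [|[|n]] // _; apply: dominantC.
- by case: n nX pn => [|[|[|n]]] // _; apply: dominantD.
- exact: dominantE.
- exact: dominantF.
- exact: dominantG.
Qed.

Lemma dynkin_mult_le3 X p q : dynkin_valid X -> (dynkin_mult X p q <= 3)%N.
Proof.
case: X => [n|n|n|n|n||] /= nX.
- by have [] := chain_weight p q (erefl (dynkin_edges (TypeA n))).
- have e : dynkin_edges (TypeB n) = rcons (chain n.-1) (n - 2, n - 1, 2)%N by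
  [].
  by have [] := rcons_weight p q e; try lia.
- have e : dynkin_edges (TypeC n) = rcons (chain n.-1) (n - 1, n - 2, 2)%N by
  [].
  by have [] := rcons_weight p q e; try lia.
- have e : dynkin_edges (TypeD n) = rcons (chain n.-1) (n - 3, n - 1, 1)%N by
  [].
  by have [] := rcons_weight p q e; try lia.
- have e : dynkin_edges (TypeE n) = rcons (chain n.-1) (2, n - 1, 1)%N by [].
  by have [] := rcons_weight p q e; try lia.
- rewrite /dynkin_mult /= !big_cons big_nil /= !xpair_eqE.
  by do 4?[case: p => [|p] //=]; do 4?[case: q => [|q] //=].
rewrite /dynkin_mult /= !big_cons big_nil /=.
by case: ifP.
Qed.

(** * The initial matrix *)

(* With [x i = v i / u i], twice the form is
   [2 sum_i d_i u_i x_i^2 (C u)_i - sum_ij d_i c_ij u_i u_j (x_i - x_j)^2]. *)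
Lemma posdef_dominant n (d u : 'I_n -> nat) (c : 'M[int]_n) :
  (forall i, (0 < d i)%N) -> (forall i, (0 < u i)%N) ->
  (forall i j, (d i)%:Z * c i j = (d j)%:Z * c j i) ->
  (forall i j, i != j -> c i j <= 0) ->
  (forall i, 0 < \sum_j c i j * (u j)%:Z) -> posdef d c.
Proof.
move=> d0 u0 cs c0 cu v [k vk].
pose U i : rat := (u i)%:R; pose G i j : rat := ((d i)%:Z * c i j)%:~R.
pose x i : rat := (v i)%:~R / U i.
have U0 i : 0 < U i by rewrite ltr0n.
have vE i : (v i)%:~R = x i * U i by rewrite /x divfK // gt_eqF.
have Gs i j : G i j = G j i by rewrite /G cs.
rewrite -(ltr0z rat) rmorph_sum /=.
have -> : \sum_i (\sum_j v i * ((d i)%:Z * c i j) * v j)%:~R =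
   \sum_i \sum_j (x i * U i) * G i j * (x j * U j) :> rat.
  apply: eq_bigr => i _; rewrite rmorph_sum; apply: eq_bigr => j _.
  by rewrite /= !intrM -!vE /G intrM.
set Q := \sum_i _.
have twice : 2 * Q = 2 * (\sum_i \sum_j x i ^+ 2 * U i * (G i j * U j))
    + \sum_i \sum_j - G i j * U i * U j * (x i - x j) ^+ 2.
  have sw : \sum_i \sum_j x i ^+ 2 * U i * (G i j * U j) =
      \sum_i \sum_j x j ^+ 2 * U j * (G i j * U i).
    rewrite exchange_big /=; apply: eq_bigr => i _; apply: eq_bigr => j _.
    by rewrite Gs.
  rewrite !(mulr_natl _ 2) !mulr2n {2}sw -!big_split /=.
  apply: eq_bigr => i _; rewrite -!big_split /=; apply: eq_bigr => j _.
  by ring.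
suff : 0 < 2 * Q by rewrite pmulr_rgt0.
rewrite twice ltr_wpDr //.
  apply: sumr_ge0 => i _; apply: sumr_ge0 => j _.
  have [-> | ij] := eqVneq i j; first by rewrite subrr expr0n mulr0.
  apply: mulr_ge0 (sqr_ge0 _); do 2!apply: mulr_ge0 (ltW (U0 _)).
  by rewrite oppr_ge0 /G lerz0 mulr_ge0_le0 // c0.
rewrite pmulr_rgt0 //.
have row i : \sum_j x i ^+ 2 * U i * (G i j * U j) =
    x i ^+ 2 * U i * ((d i)%:R * (\sum_j c i j * (u j)%:Z)%:~R).
  rewrite -big_distrr /=; congr (_ * _); rewrite rmorph_sum /= big_distrr /=.
  by apply: eq_bigr => j _; rewrite /G /U !intrM mulrA.
under eq_bigr do rewrite row.
have pos i : 0 < (d i)%:R * (\sum_j c i j * (u j)%:Z)%:~R :> rat.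
  by rewrite mulr_gt0 ?ltr0n ?ltr0z.
rewrite (bigD1 k) //= ltr_wpDr //.
  apply: sumr_ge0 => i _.
  by rewrite mulr_ge0 ?(ltW (pos i)) // mulr_ge0 ?sqr_ge0 // ltW.
apply: mulr_gt0 (pos k); apply: mulr_gt0 (U0 k).
rewrite exprn_even_gt0 //= /x mulf_neq0 ?intr_eq0 //.
by rewrite invr_eq0 gt_eqF.
Qed.

(** A positive product at most 3 is 1 or a prime, so the smaller factor is 1 and the larger one is
    the product. *)
Lemma absz_from_product (x y : int) (m : nat) (L : bool) :
  absz (x * y) = m -> (`|y| < `|x|) = L -> (x == 0) = (y == 0) -> (m <= 3)%N ->
  absz x = if m == 0%N then 0%N else if L then m else 1%N.
Proof.
rewrite abszM => e l z m3.
have {}l : (absz y < absz x)%N = L by rewrite -l; lia.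
have {z} : (absz x == 0%N) = (absz y == 0%N) by lia.
move: m3 l; rewrite -{}e; move: (absz x) (absz y) => p q m3 <- h.
have [q0 | q0] := posnP q; first by move: h; rewrite q0 muln0 eqxx => /eqP.
have p0 : (0 < p)%N by lia.
have p3 : (p <= 3)%N by apply: leq_trans m3; rewrite leq_pmulr.
have q3 : (q <= 3)%N by apply: leq_trans m3; rewrite leq_pmull.
by move: m3 p0 q0 p3 q3 {h}; case: p => [|[|[|[|p]]]] //;
  case: q => [|[|[|[|q]]]].
Qed.

Lemma tmx_parts n (Bt : 'M[int]_n) i j :
  part0 (tmx Bt i j) = 0 /\ part1 (tmx Bt i j) = Bt i j.
Proof. by rewrite !mxE part0_t_int part1_t_int. Qed.

Lemma at1_tmx n (Bt : 'M[int]_n) : map_mx at1 (tmx Bt) = Bt.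
Proof.
by apply/matrixP => i j; rewrite mxE at1E; have [-> ->] := tmx_parts Bt i j;
  rewrite add0r.
Qed.

Lemma cartan_tmx n (Bt : 'M[int]_n) i j : i != j ->
  cartan (tmx Bt) i j = - `|Bt i j|.
Proof.
by move=> ij; rewrite cartanE //; have [-> ->] := tmx_parts Bt i j;
  rewrite normr0 sub0r.
Qed.

Lemma skew_symmetrizing_at1 n (d : 'I_n -> nat) (B : 'M[Zt]_n) i j :
  skew_symmetrizing d B ->
  (d i)%:Z * at1 (B i j) = - ((d j)%:Z * at1 (B j i)).
Proof.
move=> [_ /(_ i j) /(congr1 at1)].
rewrite raddfN /= !raddfMn /=.
by rewrite -(mulr_natl (at1 (B i j))) -(mulr_natl (- at1 (B j i))) !natz mulrN.
Qed.

Lemma dynkin_positive_oriented n X (Bt : 'M[int]_n) (d : 'I_n -> nat) :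
  int_dynkin X Bt -> skew_symmetrizing d (tmx Bt) ->
  positive_oriented d (tmx Bt).
Proof.
move=> [vX _ [f fbij fE]] dB; have [d0 _] := dB.
have d0' i : 0 < (d i)%:Z by rewrite ltz_nat.
have sk i j : (d i)%:Z * Bt i j = - ((d j)%:Z * Bt j i).
  have := skew_symmetrizing_at1 i j dB.
  have e : map_mx at1 (tmx Bt) = Bt := at1_tmx Bt.
  by rewrite -{3 4}e !mxE.
have sym i j : (d i)%:Z * `|Bt i j| = (d j)%:Z * `|Bt j i|.
  have := congr1 Num.norm (sk i j).
  by rewrite normrN !normrM ![`|(d _)%:Z|]gtr0_norm.
have csym i j : (d i)%:Z * cartan (tmx Bt) i j = (d j)%:Z * cartan (tmx Bt) j i.
  have [-> // | ij] := eqVneq i j.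
  by rewrite !cartan_tmx // 1?eq_sym // !mulrN sym.
have absB i j : i != j -> absz (Bt i j) = dynkin_weight X (f i) (f j).
  move=> ij; have [e l] := fE i j ij.
  apply: absz_from_product e l _ _; last exact: dynkin_mult_le3.
  have := sk i j; have := d0' i; have := d0' j; nia.
have bc : companion d (map_mx at1 (tmx Bt)) (cartan (tmx Bt)).
  rewrite at1_tmx; split=> //.
  - by move=> i; rewrite mxE eqxx.
  - by move=> i j ij; rewrite cartan_tmx // normrN normr_id.
  apply: (@posdef_dominant _ _ (fun i => dynkin_height X (f i))) => //.
  - by move=> i; have [] := dynkin_dominant vX (ltn_ord (f i)).
  - by move=> i j ij; rewrite cartan_tmx // oppr_le0.
  move=> i; have [_ dom] := dynkin_dominant vX (ltn_ord (f i)).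
  have [g fg gf] := fbij; rewrite (reindex f) /= in dom; last first.
    by exists g => x _.
  pose F j := (dynkin_weight X (f i) (f j) * dynkin_height X (f j))%N.
  rewrite (bigD1 i) //= (eq_bigr (fun j => - (F j)%:Z)) => [|j ji]; last first.
    by rewrite cartan_tmx 1?eq_sym // mulNr /F -absB 1?eq_sym // PoszM abszE.
  rewrite sumrN mxE eqxx subr_gt0 -PoszM.
  have -> : \sum_(j | j != i) (F j)%:Z = (\sum_(j | j != i) F j)%N%:Z.
    by rewrite -[RHS]natz natr_sum; apply: eq_bigr => j _; rewrite natz.
  rewrite ltz_nat; apply: leq_ltn_trans dom.
  by rewrite [leqRHS](bigD1 i) //= leq_addl.
split=> //; first by move=> i j; have [-> _] := tmx_parts Bt i j; rewrite mul0r.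
(* Orientation holds vacuously: with nonpositive off-diagonal Cartan entries the product around a
   chordless cycle could not be negative. *)
move=> m w ch; have := companion_odd bc ch; rewrite ltNge => /negP; case.
apply: prodr_ge0 => i _; have [ne _] := chordless_edge bc ch (ltn_ord i).
by rewrite cartan_tmx // opprK.
Qed.

(** * Mutation of roots *)

Definition reflection_int n (c : 'M[int]_n) (i : 'I_n) : 'M[int]_n :=
  1%:M - delta_mx i 0 *m row i c.

Lemma reflection_int_delta n (c : 'M[int]_n) (i j : 'I_n) :
  reflection_int c i *m delta_mx j 0 =
  delta_mx j 0 - c i j *: delta_mx i 0 :> 'cV_n.
Proof.
rewrite mulmxBl mul1mx -mulmxA -colE; congr (_ - _).
by apply/matrixP => x y; rewrite !mxE big_ord1 !mxE (ord1 y) mulrC.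
Qed.

Lemma reflection_intK n (c : 'M[int]_n) i : c i i = 2 ->
  reflection_int c i *m reflection_int c i = 1%:M.
Proof.
move=> cii; rewrite {2}/reflection_int mulmxBr mulmx1 mulmxA.
rewrite reflection_int_delta cii mulmxBl -scalemxAl /reflection_int.
move: (_ *m _) => X; apply/matrixP => x y; rewrite !mxE; ring.
Qed.

Lemma simple_root_mapE (R : realType) n (j : 'I_n) :
  simple_root R j = map_mx intr (delta_mx j 0 : 'cV_n).
Proof. by apply/matrixP => x y; rewrite !mxE; case: (_ && _). Qed.

Lemma linear_extE (R : realType) n (f : 'I_n -> 'cV[R]_n) j :
  linear_ext f *m simple_root R j = f j.
Proof.
rewrite -colE; apply/matrixP => x y; by rewrite !mxE (ord1 y).
Qed.

Lemma simple_root_ext (R : realType) n (M N : 'M[R]_n) :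
  (forall j, M *m simple_root R j = N *m simple_root R j) -> M = N.
Proof.
move=> MN; apply/matrixP => x j; have := MN j; rewrite -!colE.
by move=> /matrixP /(_ x 0); rewrite !mxE.
Qed.

Lemma reflection_mapE (R : realType) n (B : 'M[Zt]_n) i :
  reflection R B i = map_mx intr (reflection_int (cartan B) i).
Proof.
apply: simple_root_ext => j; rewrite linear_extE !simple_root_mapE -map_mxM.
by rewrite reflection_int_delta map_mxB map_mxZ.
Qed.

Lemma root_mutation_delta n (k : 'I_n) (b c : 'M[int]_n) j :
  root_mutation k b c *m delta_mx j 0 =
  if 0 < b j k then reflection_int c k *m delta_mx j 0
  else delta_mx j 0 :> 'cV_n.
Proof.
rewrite reflection_int_delta /root_mutation mulmxBl mul1mx -mulmxA -colE.
have -> (X : 'cV[int]_n) : (if 0 < b j k then X - c k j *: delta_mx k 0 else X)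
  =
    X - (if 0 < b j k then c k j else 0) *: delta_mx k 0.
  by case: ifP => // _; rewrite scale0r subr0.
congr (_ - _); apply/matrixP => x y.
by rewrite !mxE big_ord1 !mxE (ord1 y) mulrC.
Qed.

Lemma rho1_mapE (R : realType) n (k : 'I_n) (A : 'M[Zt]_n) :
  rho1 R k A = map_mx intr (root_mutation k (map_mx at1 A) (cartan A)).
Proof.
apply: simple_root_ext => j; rewrite linear_extE sgn_eq1 reflection_mapE.
rewrite simple_root_mapE -!map_mxM root_mutation_delta [map_mx at1 A j k]mxE.
by case: ifP.
Qed.

Lemma gram_delta n (d : 'I_n -> nat) (c : 'M[int]_n) i : (delta_mx i 0 :
  'cV_n)^T *m gram d c = (d i)%:Z *: row i c.
Proof. by rewrite trmx_delta -rowE; apply/matrixP => x y; rewrite !mxE. Qed.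

Section Conjugation.

Variables (n : nat) (d : 'I_n -> nat) (b c : 'M[int]_n) (k : 'I_n).
Hypothesis bc : companion d b c.
Let c' := mutate_cartan k b c.
Let rho := root_mutation k b c.

Lemma root_mutationK :
  exists2 Q : 'M[int]_n, Q *m rho = 1%:M & rho *m Q = 1%:M.
Proof.
exists (1%:M + delta_mx k 0 *m (\row_j if 0 < b j k then c k j else 0)).
  exact: root_mutation_left_inverse bc.
by apply: mulmx1C; apply: root_mutation_left_inverse bc.
Qed.

Lemma gram_sym : (gram d c)^T = gram d c.
Proof. by apply/matrixP => x y; rewrite !mxE (companion_sym bc). Qed.

Lemma gram_reflection i :
  (reflection_int c i)^T *m gram d c = gram d c *m reflection_int c i.
Proof.
have Gd : gram d c *m delta_mx i 0 = (d i)%:Z *: (row i c)^T.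
  by rewrite -[LHS]trmxK trmx_mul gram_sym gram_delta linearZ.
have -> : (reflection_int c i)^T = 1%:M - (row i c)^T *m (delta_mx i 0 :
  'cV_n)^T.
  by rewrite [LHS]linearB /= trmx1 trmx_mul.
rewrite mulmxBl mul1mx -mulmxA gram_delta mulmxBr mulmx1 mulmxA Gd.
by rewrite -scalemxAl -scalemxAr.
Qed.

(** As [rho] is an isometry, it conjugates s'_i into the reflection in the image of the i-th simple
    root. That image is the simple root itself or its transform under s_k, whose reflection is s_k
    s_i s_k. *)
Lemma root_mutation_reflection i :
  rho *m reflection_int c' i =
  (if 0 < b i k
   then reflection_int c k *m reflection_int c i *m reflection_int c k
   else reflection_int c i) *m rho.
Proof.
have ckk := reflection_intK (companion_diag bc k).
have d0 : (d i)%:Z != 0 by have := companion_gt0 bc i; lia.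
have row' : (d i)%:Z *: row i c' = (rho *m delta_mx i 0)^T *m gram d c *m rho.
  by rewrite -gram_delta /c' (mutate_gram k bc) trmx_mul !mulmxA.
have inj (X Y : 'rV[int]_n) : (d i)%:Z *: X = (d i)%:Z *: Y -> X = Y.
  move=> /matrixP XY; apply/matrixP => x y; have := XY x y.
  by rewrite !mxE => /(mulfI d0).
rewrite [in LHS]/reflection_int mulmxBr mulmx1 mulmxA root_mutation_delta.
move: row'; rewrite root_mutation_delta; case: ifP => bik row'.
  have -> : row i c' = row i c *m reflection_int c k *m rho.
    apply: inj; rewrite row' trmx_mul -!mulmxA (mulmxA _ (gram d c)).
    by rewrite gram_reflection !mulmxA gram_delta -!scalemxAl.
  rewrite -{1}[rho]mul1mx -{1}ckk [X in _ - X]mulmxA -mulmxBl.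
  congr (_ *m _); rewrite [reflection_int c i]/reflection_int.
  rewrite (mulmxBr _ 1%:M (delta_mx i 0 *m row i c)) mulmx1.
  by rewrite [RHS]mulmxBl !mulmxA.
have -> : row i c' = row i c *m rho.
  by apply: inj; rewrite row' gram_delta -!scalemxAl.
by rewrite /reflection_int mulmxBl mul1mx mulmxA.
Qed.

End Conjugation.

(** The inverse is recorded because [weyl_group] is closed under [invmx], and inverting an integral
    matrix need not give an integral one. *)
Definition integral_pair (R : realType) n (w : 'M[R]_n) :=
  exists M N : 'M[int]_n, [/\ w = map_mx intr M, M *m N = 1%:M & N *m M = 1%:M].

Lemma intr_inj_mx (R : realType) m n (M N : 'M[int]_(m, n)) :
  map_mx intr M = map_mx intr N :> 'M[R]_(m, n) -> M = N.
Proof.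
move=> /matrixP MN; apply/matrixP => i j; have := MN i j.
by rewrite !mxE => /intr_inj.
Qed.

Lemma invmx_eq (R : realType) n (M N : 'M[R]_n) :
  M *m N = 1%:M -> M \in unitmx /\ invmx M = N.
Proof.
move=> MN; have [uM _] := mulmx1_unit MN; split=> //.
by rewrite -[RHS](mulKmx uM) MN mulmx1.
Qed.

Lemma weyl_integral (R : realType) n (B : 'M[Zt]_n) (w : 'M[R]_n) :
  weyl_group B w -> integral_pair w.
Proof.
elim=> [i | | u v _ [M [N [-> MN NM]]] _ [M' [N' [-> MN' NM']]] |
        u _ [M [N [-> MN NM]]]].
- have ss : reflection_int (cartan B) i *m reflection_int (cartan B) i = 1%:M.
    by apply: reflection_intK; rewrite mxE eqxx.
  by do 2!exists (reflection_int (cartan B) i); rewrite reflection_mapE.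
- by exists 1%:M, 1%:M; rewrite map_mx1 !mulmx1.
- exists (M *m M'), (N' *m N); rewrite map_mxM; split=> //.
    by rewrite mulmxA -(mulmxA M) MN' mulmx1.
  by rewrite mulmxA -(mulmxA N') NM mulmx1.
exists N, M; split=> //.
have [] // := @invmx_eq R n (map_mx intr M) (map_mx intr N).
by rewrite -map_mxM MN map_mx1.
Qed.

Lemma weyl_unit (R : realType) n (B : 'M[Zt]_n) (w : 'M[R]_n) :
  weyl_group B w -> w \in unitmx.
Proof.
move=> /weyl_integral[M [N [-> MN _]]].
by have [] // := @invmx_eq R n (map_mx intr M) (map_mx intr N);
  rewrite -map_mxM MN map_mx1.
Qed.

Lemma rho1_weyl (R : realType) n (d : 'I_n -> nat) (B : 'M[Zt]_n) k (w :
  'M[R]_n) :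
  positive_oriented d B -> weyl_group (mutate k B) w ->
  exists2 w', weyl_group B w' & rho1 R k B *m w = w' *m rho1 R k B.
Proof.
move=> [Bp bc co]; have bkk : at1 (B k k) = 0.
  by have := companion_skew_diag bc k; rewrite mxE.
elim=> [i | | u v _ [u' Wu eu] _ [v' Wv ev] | u Wu [u' Wu' eu]].
- rewrite reflection_mapE (cartan_mutate k Bp bc co) rho1_mapE -map_mxM.
  rewrite (root_mutation_reflection _ bc) map_mxM.
  eexists; last by [].
  case: ifP => _; rewrite ?map_mxM -!reflection_mapE; last exact: weyl_gen.
  by do 2?apply: weyl_mul; apply: weyl_gen.
- by exists 1%:M; [apply: weyl_one | rewrite mulmx1 mul1mx].
- exists (u' *m v'); first exact: weyl_mul.
  by rewrite mulmxA eu -mulmxA ev mulmxA.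
exists (invmx u'); first exact: weyl_inv.
have Uu := weyl_unit Wu; have Uu' := weyl_unit Wu'.
by rewrite -[RHS](mulmxK Uu) -(mulmxA _ _ u) eu mulKmx.
Qed.

Lemma rho1_Phi (R : realType) n (d : 'I_n -> nat) (B : 'M[Zt]_n) k (v :
  'cV[R]_n) :
  positive_oriented d B -> Phi (mutate k B) v -> Phi B (rho1 R k B *m v).
Proof.
move=> Bpo [w [j [Ww ->]]].
have [w' Ww' e] := rho1_weyl Bpo Ww.
rewrite mulmxA e -mulmxA linear_extE; case: ifP => _; last by exists w', j.
exists (w' *m reflection R B k), j; rewrite mulmxA; split=> //.
by apply: weyl_mul => //; apply: weyl_gen.
Qed.

Lemma rho_Phi (R : realType) n (d : 'I_n -> nat) (A : 'M[Zt]_n) ks (v :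
  'cV[R]_n) :
  positive_oriented d A -> Phi (mutations ks A) v -> Phi A (rho R ks A *m v).
Proof.
elim: ks A => [|k ks IH] A Apo /=; first by rewrite mul1mx.
move=> Pv; rewrite -mulmxA; apply: (rho1_Phi Apo).
exact: IH (mutate_positive_oriented k Apo) Pv.
Qed.

Lemma rho_isometry (R : realType) n (d : 'I_n -> nat) (A : 'M[Zt]_n) ks :
  positive_oriented d A ->
  exists P Q : 'M[int]_n, [/\ rho R ks A = map_mx intr P,
    P *m Q = 1%:M, Q *m P = 1%:M &
    gram d (cartan (mutations ks A)) = P^T *m gram d (cartan A) *m P].
Proof.
elim: ks A => [|k ks IH] A Apo /=.
  by exists 1%:M, 1%:M; rewrite map_mx1 trmx1 !mulmx1 mul1mx.
have [P [Q [eP PQ QP eG]]] := IH _ (mutate_positive_oriented k Apo).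
have [Ap bc co] := Apo; have [Q1 Q1P P1Q1] := root_mutationK k bc.
exists (root_mutation k (map_mx at1 A) (cartan A) *m P), (Q *m Q1).
rewrite eP rho1_mapE map_mxM; split=> //.
- by rewrite mulmxA -(mulmxA _ P) PQ mulmx1.
- by rewrite mulmxA -(mulmxA Q) Q1P mulmx1.
by rewrite eG (cartan_mutate k Ap bc co) (mutate_gram k bc) trmx_mul !mulmxA.
Qed.

Lemma dotpE (R : realType) n (d : 'I_n -> nat) (B : 'M[Zt]_n) (u v : 'cV[R]_n) :
  dotp d B u v = (u^T *m map_mx intr (gram d (cartan B)) *m v) 0 0.
Proof.
rewrite /dotp -(mulmxA u^T); congr ((_ *m _ *m _) 0 0).
rewrite mul_diag_mx; apply/matrixP => i j; rewrite !mxE intrM.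
by rewrite -[LHS]/((d i)%:R * _).
Qed.

Lemma Phi_integral (R : realType) n (B : 'M[Zt]_n) (v : 'cV[R]_n) :
  Phi B v -> exists z : 'cV[int]_n, v = map_mx intr z.
Proof.
move=> [w [j [/weyl_integral[M [N [-> _ _]]] ->]]].
by exists (M *m delta_mx j 0); rewrite map_mxM simple_root_mapE.
Qed.

Lemma simple_root_sum (R : realType) n (c : 'I_n -> int) :
  \sum_i simple_root R i *~ c i = map_mx intr (\col_i c i).
Proof.
apply/matrixP => i j; rewrite !mxE summxE (bigD1 i) //= big1 => [|l li].
  by rewrite addr0 -scaler_int !mxE (ord1 j) !eqxx mulr1.
by rewrite -scaler_int !mxE eq_sym (negPf li) mulr0.
Qed.

(** The Weyl group acts by integer matrices and simple roots are roots, so the root lattice is the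
    standard lattice. Being a basis of it then amounts to unimodularity. *)
Lemma Zspan_Phi (R : realType) n (B : 'M[Zt]_n) (v : 'cV[R]_n) :
  Zspan (Phi B) v <-> exists z : 'cV[int]_n, v = map_mx intr z.
Proof.
split=> [[m [s [sPhi [a ->]]]] | [z ->]].
  suff : forall i : 'I_m, exists z : 'cV[int]_n, s`_i *~ a i = map_mx intr z.
    move=> sz; elim/big_ind: _ => [|x y [zx ->] [zy ->]|i _]; last exact: sz.
      by exists 0; rewrite map_mx0.
    by exists (zx + zy); rewrite map_mxD.
  move=> i; have := sPhi i; rewrite (tnth_nth 0) => /Phi_integral[z ->].
  exists (z *~ a i); apply/matrixP => x y.
  by rewrite -!scaler_int !mxE intrM intz.
exists n, [tuple simple_root R i | i < n]; split.
  move=> i; rewrite tnth_mktuple; exists 1%:M, i.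
  by split; [apply: weyl_one | rewrite mul1mx].
exists [ffun i => z i 0].
under eq_bigr do rewrite (nth_mktuple _ _ _) ffunE.
by rewrite simple_root_sum; congr map_mx; apply/matrixP => i j;
  rewrite mxE ord1.
Qed.

Lemma rho_signed_companion_basis (R : realType) n (d : 'I_n -> nat)
    (A : 'M[Zt]_n) (ks : seq 'I_n) : positive_oriented d A ->
  signed_companion_basis d A (mutations ks A)
    (fun i => rho R ks A *m simple_root R i).
Proof.
move=> Apo; have [P [Q [-> PQ QP eG]]] := rho_isometry R ks Apo.
have Bpo : positive_oriented d (mutations ks A).
  by elim: ks A Apo {P Q PQ QP eG} => //= k ks IH A Apo;
    apply/IH/mutate_positive_oriented.
have [_ bc _] := Bpo.
have sumP c : \sum_i map_mx intr P *m simple_root R i *~ c i =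
    map_mx intr (P *m \col_i c i).
  rewrite map_mxM -simple_root_sum mulmx_sumr; apply: eq_bigr => i _.
  by rewrite -!scaler_int scalemxAr.
split; first split.
- move=> v; rewrite Zspan_Phi; split=> [[z ->] | [c ->]].
    exists (fun i => (Q *m z) i 0); rewrite sumP; congr map_mx.
    rewrite -[LHS]mul1mx -PQ -mulmxA; congr (_ *m _).
    by apply/matrixP => i j; rewrite [RHS]mxE ord1.
  by rewrite sumP; exists (P *m \col_i c i).
- move=> c; rewrite sumP => P0.
  have {}P0 : P *m \col_i c i = 0.
    by apply: (@intr_inj_mx R); rewrite P0 map_mx0.
  move=> i; have := congr1 (mulmx Q) P0; rewrite mulmxA QP mul1mx mulmx0.
  by move=> /matrixP /(_ i 0); rewrite !mxE.
have dotP i j : dotp d A (map_mx intr P *m simple_root R i)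
    (map_mx intr P *m simple_root R j) =
    (gram d (cartan (mutations ks A)) i j)%:~R.
  rewrite dotpE !simple_root_mapE -!map_mxM map_trmx -!map_mxM mxE.
  rewrite trmx_mul -!mulmxA (mulmxA _ _ (delta_mx j 0)) (mulmxA P^T).
  by rewrite (mulmxA P^T) -eG mulmxA trmx_delta -rowE -colE !mxE.
have d0 i : (d i)%:R != 0 :> R by rewrite pnatr_eq0 -lt0n (companion_gt0 bc).
have ii i : gram d (cartan (mutations ks A)) i i = (d i)%:Z * 2.
  by rewrite mxE (companion_diag bc).
apply/matrixP => i j; rewrite mxE [RHS]mxE /coroot.
have dotZ a (u v : 'cV[R]_n) : dotp d A u (a *: v) = a * dotp d A u v.
  by rewrite !dotpE -scalemxAr mxE.
(* The norm of the i-th vector is 2 d_i, so the pairing is d_j c_ji / d_i, which equals c_ij by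
   symmetry of the Gram matrix. *)
rewrite dotZ !dotP ii mxE (companion_sym bc) !intrM -[(d i)%:~R]/((d i)%:R : R).
by field; rewrite d0.
Qed.

(** * Reduction to the matrices [t Bt] *)

Lemma mutations_cat n (ks ls : seq 'I_n) (B : 'M[Zt]_n) :
  mutations (ks ++ ls) B = mutations ls (mutations ks B).
Proof. by elim: ks B => //= k ks IH B. Qed.

Definition row_sign (x : Zt) : Zt :=
  if 0 < at1 x then - x else if at1 x < 0 then - (t * x) else x.

Definition col_sign (x : Zt) : Zt :=
  if 0 < at1 x then - (t * x) else if at1 x < 0 then - x else x.

Lemma mutateE n (k : 'I_n) (B : 'M[Zt]_n) i j : B k k = 0 ->
  mutate k B i j =
    if i == k then row_sign (B i j) else if j == k then col_sign (B i j)
    else if 0 < at1 (B i k) * at1 (B k j) then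
      t * (B i j + (sgn (B i k))%:~R * B i k * B k j)
    else B i j.
Proof.
move=> bkk; rewrite mxE /= !sgn_eq1 !sgn_eqN1 at1M /row_sign /col_sign.
have [-> | ik] := eqVneq i k; have [-> | jk] := eqVneq j k => //=.
- by rewrite bkk raddf0 mul0r ltxx.
- by rewrite !orbF bkk raddf0 mul0r ltxx.
by rewrite bkk raddf0 mulr0 ltxx; case: (ltgtP 0 (at1 (B i k))).
Qed.

Lemma at1_row_sign x : at1 (row_sign x) = - at1 x.
Proof.
rewrite /row_sign; case: (ltgtP 0 (at1 x)) => [_|_|<-]; rewrite ?oppr0 //.
  by rewrite raddfN.
by rewrite raddfN /= at1M at1_t mul1r.
Qed.

Lemma at1_col_sign x : at1 (col_sign x) = - at1 x.
Proof.
rewrite /col_sign; case: (ltgtP 0 (at1 x)) => [_|_|<-]; rewrite ?oppr0 //.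
  by rewrite raddfN /= at1M at1_t mul1r.
by rewrite raddfN.
Qed.

Lemma row_sign_twice x :
  row_sign (row_sign x) = if at1 x == 0 then x else t * x.
Proof.
rewrite {1}/row_sign at1_row_sign oppr_gt0 oppr_lt0 /row_sign.
by case: (ltgtP (at1 x) 0) => //= _; rewrite ?mulrN !opprK.
Qed.

Lemma col_sign_twice x :
  col_sign (col_sign x) = if at1 x == 0 then x else t * x.
Proof.
rewrite {1}/col_sign at1_col_sign oppr_gt0 oppr_lt0 /col_sign.
by case: (ltgtP (at1 x) 0) => //= _; rewrite ?mulrN !opprK.
Qed.

Lemma sign_product x y : 0 < at1 x * at1 y ->
  col_sign x * row_sign y = t * (x * y) /\ sgn (col_sign x) = - sgn x.
Proof.
move=> xy; rewrite !sgnE at1_col_sign sgrN; split=> //.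
rewrite /col_sign /row_sign; case: (ltgtP 0 (at1 x)) xy => [x0|x0|<-].
- by rewrite pmulr_rgt0 // => ->; rewrite mulrNN mulrA.
- rewrite nmulr_rgt0 // => y0; rewrite y0 ltNge (ltW y0) /=.
  by rewrite mulrNN mulrCA.
- by rewrite mul0r ltxx.
Qed.

(** Off row and column k the second mutation removes the product added by the first, its sign being
    reversed, and the factors t cancel. On row or column k an entry is negated twice and gains one
    factor t, unless its value at t = 1 vanishes: 1 - t, for instance, is nonzero but has sign 0 and
    stays. *)
Lemma mutate_twice n (k : 'I_n) (B : 'M[Zt]_n) i j : B k k = 0 ->
  mutate k (mutate k B) i j =
    if ((i == k) || (j == k)) && (at1 (B i j) != 0) then t * B i j else B i j.
Proof.
move=> bkk; have bkk' : mutate k B k k = 0.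
  by rewrite mutateE // eqxx bkk /row_sign raddf0 ltxx.
rewrite mutateE // !mutateE // !eqxx.
have [-> | ik] := eqVneq i k; first by rewrite row_sign_twice; case: eqP.
have [-> | jk] := eqVneq j k; first by rewrite col_sign_twice; case: eqP.
rewrite at1_col_sign at1_row_sign mulrNN /=; case: ifP => p; last by rewrite p.
have [e ->] := sign_product p; rewrite -(mulrA _ (col_sign _)) e.
rewrite p rmorphN /= -[RHS]mul1r -[in RHS]t_sqr; ring.
Qed.

Lemma mutate_four n (k : 'I_n) (B : 'M[Zt]_n) : B k k = 0 ->
  mutate k (mutate k (mutate k (mutate k B))) = B.
Proof.
move=> bkk; have bkk2 : mutate k (mutate k B) k k = 0.
  by rewrite mutate_twice // bkk mulr0 if_same.
apply/matrixP => i j; rewrite mutate_twice // mutate_twice //.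
case: (_ || _) => //=; have [b0 | bn] := eqVneq (at1 (B i j)) 0;
  rewrite /= ?b0 ?eqxx //.
by rewrite at1M at1_t mul1r bn mulrA t_sqr mul1r.
Qed.

Lemma skew_symmetrizing_diag n (d : 'I_n -> nat) (B : 'M[Zt]_n) i :
  skew_symmetrizing d B -> B i i = 0.
Proof.
move=> [d0 dB].
have P (f : {additive Zt -> int}) : f (B i i) = 0.
  have := congr1 f (dB i i); rewrite raddfN /= raddfMn /= => h.
  have {}h : f (B i i) *+ (d i + d i) = 0 by rewrite mulrnDr {1}h addNr.
  by move/eqP: h; rewrite mulrn_eq0 addn_eq0 andbb eqn0Ngt d0 => /eqP.
by apply: Zt_eq; rewrite raddf0 P.
Qed.

Lemma skew_symmetrizing_gt0 n (d : 'I_n -> nat) (B : 'M[Zt]_n) i j :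
  skew_symmetrizing d B -> (0 < at1 (B i j)) = (at1 (B j i) < 0).
Proof.
move=> dB; have [d0 _] := dB; have := skew_symmetrizing_at1 i j dB.
by have := d0 i; have := d0 j; nia.
Qed.

Lemma row_col_sign (x y : Zt) (p q : nat) :
  (0 < at1 x) = (at1 y < 0) -> (0 < at1 y) = (at1 x < 0) ->
  x *+ p = - (y *+ q) -> row_sign x *+ p = - (col_sign y *+ q).
Proof.
rewrite /row_sign /col_sign => -> <- e.
case: (ltgtP (at1 y) 0) => y0 //=; first by rewrite !mulNrn e.
by rewrite !mulNrn -!mulrnAr e mulrN.
Qed.

(** Stated over Z[t]/(t^2 - 1) and without positivity, because the reduction to [tmx] and the
    inversion of mutations take place before positivity is available. *)
Lemma mutate_skew_symmetrizing n (d : 'I_n -> nat) (B : 'M[Zt]_n) k :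
  skew_symmetrizing d B -> skew_symmetrizing d (mutate k B).
Proof.
move=> dB; have [d0 skB] := dB; have bkk := skew_symmetrizing_diag k dB.
have sg i j := skew_symmetrizing_gt0 i j dB.
split=> // i j; rewrite !mutateE //.
have [-> | ik] := eqVneq i k; have [-> | jk] := eqVneq j k.
- by rewrite bkk /row_sign raddf0 ltxx mul0rn oppr0.
- by apply: row_col_sign.
- by rewrite -[LHS]opprK; congr (- _); symmetry; apply: row_col_sign.
have p_sym : (0 < at1 (B j k) * at1 (B k i)) = (0 < at1 (B i k) * at1 (B k j)).
  have := sg i k; have := sg k i; have := sg j k; have := sg k j.
  by move: (at1 (B i k)) (at1 (B k j)) (at1 (B k i)) (at1 (B j k)) => x y z w;
     clear; nia.
rewrite p_sym; case: ifP => // p.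
have s_sym : sgn (B j k) = - sgn (B i k).
  have := sg i k; have := sg k j; have := sg k i; have := sg j k.
  rewrite !sgnE; move: p.
  by move: (at1 (B i k)) (at1 (B k j)) (at1 (B k i)) (at1 (B j k)) => x y z w;
     case: sgrP; case: sgrP; nia.
rewrite s_sym rmorphN /= -!(mulr_natr (t * _)).
have e1 := skB i j; have e2 := skB i k; have e3 := skB k j.
rewrite -(mulr_natr (B i j)) -(mulr_natr (B j i)) in e1.
rewrite -(mulr_natr (B i k)) -(mulr_natr (B k i)) in e2.
rewrite -(mulr_natr (B k j)) -(mulr_natr (B j k)) in e3.
rewrite (_ : _ * (d i)%:R = t * (B i j * (d i)%:R +
  (sgn (B i k))%:~R * (B i k * (d i)%:R) * B k j)); last by ring.
rewrite e1 e2 (_ : _ * - _ * _ =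
  - ((sgn (B i k))%:~R * B k i * (B k j * (d k)%:R))); last by ring.
by rewrite e3; ring.
Qed.

Lemma mutations_skew_symmetrizing n (d : 'I_n -> nat) (B : 'M[Zt]_n) ks :
  skew_symmetrizing d B -> skew_symmetrizing d (mutations ks B).
Proof.
by elim: ks B => //= k ks IH B dB; apply/IH/mutate_skew_symmetrizing.
Qed.

Lemma mutations_inverse n (d : 'I_n -> nat) (A B : 'M[Zt]_n) ks :
  skew_symmetrizing d A -> A = mutations ks B -> exists ls, B = mutations ls A.
Proof.
move=> dA; elim: ks B => [|k ks IH] B /= eA; first by exists [::].
have [ls e] := IH _ eA.
have kk : mutate k B k k = 0.
  by rewrite e; apply/skew_symmetrizing_diag/mutations_skew_symmetrizing/dA.
(* The vanishing diagonal entry of [B] is read back from the mutated one: a nonzero sign at (k, k)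
   leads to the first branch, which negates, and sign 0 leaves the entry as it is. *)
have bkk : B k k = 0.
  move: kk; rewrite mxE eqxx /=.
  case: ifP => [_ /eqP|h]; first by rewrite oppr_eq0 => /eqP.
  rewrite [X in if X then _ else _](_ : _ = false); last first.
    by move: h; rewrite orbC.
  rewrite ifN // sgn_eq1 at1M.
  move: h; rewrite sgn_eq1 sgn_eqN1; move: (at1 _) => x; clear; nia.
(* The fourth power of the mutation at k is the identity, so its cube undoes it. *)
exists (ls ++ [:: k; k; k]); rewrite mutations_cat -e /=.
by rewrite mutate_four.
Qed.

(* A Dynkin diagram is a tree in which the parent of [q] is the only smaller
   neighbour of [q]. *)
Lemma dynkin_parent_unique X p p' q : dynkin_valid X ->
  (p < q)%N -> (p' < q)%N ->
  dynkin_mult X p q != 0%N -> dynkin_mult X p' q != 0%N -> p = p'.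
Proof.
have weight0 r : dynkin_mult X r q != 0%N -> dynkin_weight X r q != 0%N.
  by move=> m0; rewrite /dynkin_weight (negPf m0); case: ifP.
move=> vX pq pq' /weight0 h /weight0; move: h.
have tail N a b m : dynkin_edges X = rcons (chain N) (a, b, m) -> a != b ->
    (N <= maxn a b)%N -> (0 < m <= 3)%N ->
    dynkin_weight X p q != 0%N -> dynkin_weight X p' q != 0%N -> p = p'.
  move=> e ab Nab m13.
  have edge r : (r < q)%N -> dynkin_weight X r q != 0%N ->
      (q == r.+1) && (q < N)%N || (q == maxn a b) && (r == minn a b).
    move=> rq; have [-> _] := rcons_weight r q e ab Nab m13.
    have [/andP[/eqP ra /eqP qb] _ | _] := boolP ((r == a) && (q == b)).
      by apply/orP; right; lia.
    have [/andP[/eqP rb /eqP qa] _ | _] := boolP ((r == b) && (q == a)).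
      by apply/orP; right; lia.
    by rewrite mul0n !addn0 eqb0 negbK /neighbors; lia.
  by move=> /(edge _ pq) h1 /(edge _ pq') h2; lia.
case: X vX {weight0} tail => [n|n|n|n|n||] /= vX tail.
- have [-> _] := chain_weight p q (erefl (dynkin_edges (TypeA n))).
  have [-> _] := chain_weight p' q (erefl (dynkin_edges (TypeA n))).
  by rewrite /neighbors; lia.
- by apply: (tail _ _ _ _ erefl); lia.
- by apply: (tail _ _ _ _ erefl); lia.
- by apply: (tail _ _ _ _ erefl); lia.
- by apply: (tail _ _ _ _ erefl); lia.
- rewrite /dynkin_weight /dynkin_mult /= !big_cons !big_nil /= !xpair_eqE.
  by move: q pq pq' {tail} => [|[|[|[|q]]]]; move: p => [|[|[|p]]] //=;
    move: p' => [|[|[|p']]] //=; lia.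
rewrite /dynkin_weight /dynkin_mult /= !big_cons !big_nil /= !xpair_eqE.
by move: q pq pq' {tail} => [|[|q]]; move: p => [|p] //=;
  move: p' => [|p'] //=; lia.
Qed.

Lemma pure_pure_parts n (B : 'M[Zt]_n) : pure B -> pure_parts B.
Proof.
move=> pB i j; have [a [->|->]] := pB i j.
  by rewrite part1_int mulr0.
by rewrite part0_t_int mul0r.
Qed.

(** Vertices are treated in the order of their labels. A new vertex [q] is joined to at most one
    earlier vertex; if that entry lies in Z, mutating twice at [q] moves it to tZ without touching
    the earlier entries. Entries towards later vertices may be moved too, but they stay pure and are
    corrected in their turn. *)
Lemma dynkin_mutation_tmx n X (A : 'M[Zt]_n) : gss_dynkin X A ->
  exists ks, mutations ks A = tmx (map_mx at1 A).
Proof.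
move=> [vX [d dA] /pure_pure_parts pA [f fbij fE]].
pose inv M := [/\ skew_symmetrizing d M, pure_parts M & map_mx at1 M = map_mx
  at1 A].
suff : forall r, exists2 ks, inv (mutations ks A) &
    forall i j, (f i < r)%N -> (f j < r)%N -> part0 (mutations ks A i j) = 0.
  move=> /(_ (dynkin_rank X)) [ks]; set M := mutations ks A => -[dM pM eM] M0.
  exists ks; apply/matrixP => i j; have [t0 t1] := tmx_parts (map_mx at1 A) i j.
  apply: Zt_eq; rewrite ?t0 ?t1 ?M0 //.
  by rewrite -eM mxE at1E M0 // add0r.
elim=> [|r [ks]]; first by exists [::].
set M := mutations ks A => -[dM pM eM] M0.
have [rX | Xr] := ltnP r (dynkin_rank X); last first.
  by exists ks => // i j _ _; apply: M0; apply: leq_trans (ltn_ord _) Xr.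
have [g fg gf] := fbij; pose q := g (Ordinal rX).
have fq : f q = Ordinal rX by rewrite gf.
have qE i : (f i < r.+1)%N -> ~~ (f i < r)%N -> i = q.
  move=> ir nir; rewrite -(fg i) /q; congr g; apply: val_inj => /=; lia.
have M00 i : M i i = 0 := skew_symmetrizing_diag i dM.
have at0 i j : at1 (M i j) = 0 -> M i j = 0.
  have := pM i j; rewrite at1E => /eqP; rewrite mulf_eq0.
  by case/orP=> /eqP e0; rewrite e0 ?add0r ?addr0 => e1; apply: Zt_eq;
    rewrite ?e0 ?e1 raddf0.
have sk0 i j : part0 (M i j) = 0 -> part0 (M j i) = 0.
  have [d0 /(_ i j) /(congr1 part0)] := dM;
    rewrite raddfN /= !raddfMn /= => e h.
  by move/eqP: e; rewrite h mul0rn eq_sym mulrn_eq0 oppr_eq0 eqn0Ngt d0 => /eqP.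
have [/existsP[p /andP[pr p0]] | nn] :=
    boolP [exists p, (f p < r)%N && (part0 (M p q) != 0)]; last first.
  exists ks => // i j ir jr.
  have col l : (f l < r)%N -> part0 (M l q) = 0.
    by move=> lr; apply/eqP; apply: contraNT nn => h; apply/existsP; exists l;
      rewrite lr.
  have [ir' | /(qE _ ir) ->] := boolP (f i < r)%N.
    have [jr' | /(qE _ jr) ->] := boolP (f j < r)%N; [exact: M0 | exact: col].
  have [jr' | /(qE _ jr) ->] := boolP (f j < r)%N; first by apply/sk0/col.
  by rewrite M00 raddf0.
have twice i j : mutate q (mutate q M) i j =
    if (i == q) || (j == q) then t * M i j else M i j.
  rewrite mutate_twice //; case: (_ || _) => //=.
  by case: eqP => // /at0 ->; rewrite mulr0.
have part_t x : part0 (t * x) = part1 x /\ part1 (t * x) = part0 x.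
  by rewrite part0M part1M part0_t part1_t !mul0r !mul1r !add0r.
exists (ks ++ [:: q; q]); rewrite mutations_cat -/M /=.
  split.
  - by do 2!apply: mutate_skew_symmetrizing.
  - move=> i j; rewrite twice; case: ifP => // _.
    by have [-> ->] := part_t (M i j); rewrite mulrC.
  - rewrite -eM; apply/matrixP => i j; rewrite mxE [RHS]mxE twice.
    by case: ifP => // _; rewrite at1M at1_t mul1r.
have mult l : (f l < r)%N -> M l q != 0 -> dynkin_mult X (f l) r != 0%N.
  move=> lr lq; have lnq : l != q by apply: contraTneq lr => ->;
    rewrite fq /= ltnn.
  have [e _] := fE l q lnq; rewrite fq /= in e; rewrite -e absz_eq0 -eM !mxE.
  have alq : at1 (M l q) != 0 by apply: contraNneq lq => /at0 ->.
  rewrite mulf_neq0 //; apply: contraNneq alq => aql.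
  have := skew_symmetrizing_at1 l q dM; rewrite aql mulr0 oppr0 => /eqP.
  by rewrite mulf_eq0 => /orP[|//]; have [d0 _] := dM; have := d0 l; lia.
have Mpq : M p q != 0 by apply: contraNneq p0 => ->; rewrite raddf0.
have col l : (f l < r)%N -> part1 (M l q) = 0.
  move=> lr; have [-> | lq] := eqVneq (M l q) 0; first by rewrite raddf0.
  have lp : l = p.
    have := dynkin_parent_unique vX lr pr (mult l lr lq) (mult p pr Mpq).
    by move/val_inj => /(can_inj fg).
  have := pM l q; rewrite lp => /eqP; rewrite mulf_eq0 (negPf p0).
  by move/eqP.
have sk1 i j : part1 (M i j) = 0 -> part1 (M j i) = 0.
  have [d0 /(_ i j) /(congr1 part1)] := dM;
    rewrite raddfN /= !raddfMn /= => e h.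
  by move/eqP: e; rewrite h mul0rn eq_sym mulrn_eq0 oppr_eq0 eqn0Ngt d0 => /eqP.
move=> i j ir jr; rewrite twice.
have [ir' | /(qE _ ir) ->] := boolP (f i < r)%N.
  have inq : i != q by apply: contraTneq ir' => ->; rewrite fq /= ltnn.
  have [jr' | /(qE _ jr) ->] := boolP (f j < r)%N; last first.
    by rewrite eqxx orbT; have [-> _] := part_t (M i q); apply: col.
  have jnq : j != q by apply: contraTneq jr' => ->; rewrite fq /= ltnn.
  by rewrite (negPf inq) (negPf jnq) M0.
rewrite eqxx /=; have [-> _] := part_t (M q j).
have [jr' | /(qE _ jr) ->] := boolP (f j < r)%N; first by apply/sk1/col.
by rewrite M00 raddf0.
Qed.

Lemma gss_dynkin_int_dynkin n X (A : 'M[Zt]_n) :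
  gss_dynkin X A -> int_dynkin X (map_mx at1 A).
Proof.
move=> [vX [d [d0 dA]] _ fX]; split=> //; exists d; split=> // i j.
by rewrite !mxE -raddfMn dA raddfN raddfMn.
Qed.

Lemma tmx_skew_symmetrizing n (d : 'I_n -> nat) (Bt : 'M[int]_n) :
  skew_symmetrizing d Bt -> skew_symmetrizing d (tmx Bt).
Proof.
move=> [d0 dB]; split=> // i j; rewrite !mxE -!mulrnAr -mulrN.
by rewrite -!rmorphMn /= dB rmorphN.
Qed.

Theorem theorem3p22 (R : realType) (n : nat) (B : 'M[Zt]_n)
    (hB : mutation_dynkin B) :
  (exists (X : dynkin_type) (Bt : 'M[int]_n) (ks : seq 'I_n),
      int_dynkin X Bt /\ B = mutations ks (tmx Bt)) /\
  (forall (X : dynkin_type) (Bt : 'M[int]_n) (d : 'I_n -> nat) (ks : seq 'I_n),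
      int_dynkin X Bt ->
      skew_symmetrizing d (tmx Bt) ->
      B = mutations ks (tmx Bt) ->
      (forall b : 'cV[R]_n, Phi B b ->
         Phi (tmx Bt) (rho R ks (tmx Bt) *m b)) /\
      signed_companion_basis d (tmx Bt) B
        (fun i => rho R ks (tmx Bt) *m simple_root R i)).
Proof.
split.
  have [X [A [dynA [ks eAB]]]] := hB.
  have iX := gss_dynkin_int_dynkin dynA; exists X, (map_mx at1 A).
  have [ls els] := dynkin_mutation_tmx dynA.
  have [_ [d dBt] _] := iX; have [_ [dA skA] _ _] := dynA.
  (* The Dynkin matrix [A] reaches [tmx] of its values at t = 1; inverting this sequence makes [tmx]
     the starting point. The sequence between [A] and [B] may run either way and is inverted if
     necessary. *)
  have [ls' eA] := mutations_inverse (tmx_skew_symmetrizing dBt) (esym els).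
  have [ms eB] : exists ms, B = mutations ms A.
    by case: eAB => e; [exists ks | apply: mutations_inverse skA e].
  by exists (ls' ++ ms); rewrite mutations_cat -eA.
move=> X Bt d ks iX dBt eB.
have po := dynkin_positive_oriented iX dBt.
rewrite eB; split; last exact: rho_signed_companion_basis.
by move=> b; apply: rho_Phi po.
Qed.
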